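(* Let $V_h^r$ over a triangulation $\mathcal{T}$ be such that it contains the conforming subspace $V_{h,c}^r:=V_h^r\cap H^1_0(\Omega)$ of the same polynomial degree. Assume also that the recovery operator $\mathcal{E}:V_h^r\to\widetilde V$ used in the R-FEM is such that it preserves conforming functions, i.e. $\mathcal{E}(v_h)=v_h$ for all $v_h\in V_{h,c}^r$, and assume also that the stabilisation $s_h$ is such that $s_h(w_h,v_h)=0$ for all $w_h\in V_h^r$ and $v_h\in V_{h,c}^r$. Then $\mathcal{E}(u_h)=u_h^{FEM}$, when $u_h\in V_h^r$ is computed via the R-FEM, i.e. \[ a(\mathcal{E}(u_h),\mathcal{E}(v_h))+s_h(u_h,v_h)=\ell(\mathcal{E}(v_h))\quad\text{for all }v_h\in V_h^r, \] and $u_h^{FEM}\in V_{h,c}^r$ is computed via the conforming finite element method, i.e. \[ a(u_h^{FEM},v_h)=\ell(v_h)\quad\text{for all }v_h\in V_{h,c}^r. \]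
   Context: $\Omega\subset\mathbb{R}^d$, $d\in\{2,3\}$, is a bounded open polygonal domain, $f\in H^{-1}(\Omega)$, $A\in[L^\infty(\Omega)]^{d\times d}$ is a uniformly positive definite diffusion tensor; $a(w,v):=\sum_{T\in\mathcal{T}}\int_T A\nabla w\cdot\nabla v\,dx$ and $\ell(v):=\int_\Omega fv\,dx$ for $w,v\in\prod_{T\in\mathcal{T}}H^1(T)$. $\mathcal{T}$ is a regular, shape-regular, locally quasi-uniform subdivision of $\Omega$ into disjoint simplicial or box-type (quadrilateral/hexahedral) elements with straight/planar facets. For an integer $r\ge 0$, $V_h^r:=\{v\in L^2(\Omega): v|_T\in\mathcal{R}_r(T),\ T\in\mathcal{T}\}$, where $\mathcal{R}_r(T)$ is either the space of polynomials of total degree at most $r$ or the space of polynomials of degree at most $r$ in each variable. A recovery operator is a map $\mathcal{E}:V_h^r\to\widetilde V$ with $\widetilde V\in\{H^1_0(\Omega)\cap V_h^m,\ V_{nc}\}$, where $m$ is a non-negative integer and $V_{nc}$ is some classical non-conforming finite element space (e.g. of Crouzeix–Raviart elements). The stabilisation is a symmetric bilinear form $s_h:V_h^r\times V_h^r\to\mathbb{R}$.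
   Formalization: The recovery operator is additionally assumed to map V_h^r into the conforming space V_{h,c}^r of the same degree; for a larger target space (m > r, or a non-conforming V_nc) the claim fails, e.g. r = 0 with averaging into continuous Q1 functions and s_h the L^2 product. *)

(* Defs.v *)
From HB Require Import structures.
From mathcomp Require Import all_boot all_order all_algebra.
From mathcomp Require Import all_classical all_reals all_analysis.

Set Implicit Arguments.
Unset Strict Implicit.
Unset Printing Implicit Defensive.
Import Order.TTheory GRing.Theory Num.Theory.
Import numFieldNormedType.Exports.

Local Open Scope classical_set_scope.
Local Open Scope ring_scope.

(* Borel sets of R^n as the product sigma-algebra. *)
Section rV_measurable.
Context (R : realType) (n : nat).

Let coord (i : 'I_n) (x : 'rV[R]_n) : R := x 0 i.

Let rV_set0 : g_sigma_preimage coord set0.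
Proof. exact: sigma_algebra0. Qed.

Let rV_setC A : g_sigma_preimage coord A -> g_sigma_preimage coord (~` A).
Proof. exact: sigma_algebraC. Qed.

Let rV_bigcup (F : (set 'rV[R]_n)^nat) :
  (forall i, g_sigma_preimage coord (F i)) ->
  g_sigma_preimage coord (\bigcup_i (F i)).
Proof. exact: sigma_algebra_bigcup. Qed.

HB.instance Definition _ := @isMeasurable.Build default_measure_display
  'rV[R]_n (g_sigma_preimage coord) rV_set0 rV_setC rV_bigcup.

Lemma measurable_coord (i : 'I_n) :
  measurable_fun [set: 'rV[R]_n] (fun x => x 0 i).
Proof.
move=> _ Y mY; rewrite setTI; apply: sub_sigma_algebra => /=.
rewrite -bigcup_seq/=; exists i => /=; first by rewrite mem_index_enum.
by exists Y => //; rewrite setTI.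
Qed.

Lemma measurable_fun_rVP d (T : measurableType d) (f : T -> 'rV[R]_n) :
  (forall i, measurable_fun setT (fun t => f t 0 i)) -> measurable_fun setT f.
Proof.
move=> mf.
suff: g_sigma_preimage (fun i => coord i \o f) `<=` measurable.
  rewrite g_sigma_preimage_comp => sub _ A mA.
  by apply: sub; exists A.
apply: smallest_sub; first exact: sigma_algebra_measurable.
rewrite -bigcup_seq => A [i _] [B mB <-]; exact: mf.
Qed.

End rV_measurable.

Section lebesgue_measure_rV.
Context (R : realType).

Definition rV_rcons n (p : 'rV[R]_n * measurableTypeR R) : 'rV[R]_n.+1 :=
  \row_i oapp (p.1 0) p.2 (unlift ord_max i).

Lemma measurable_rV_rcons n : measurable_fun setT (@rV_rcons n).
Proof.
apply: measurable_fun_rVP => i.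
case E : (unlift ord_max i) => [j|].
  suff -> : (fun t => rV_rcons t 0 i) = (fun x : 'rV[R]_n => x 0 j) \o fst.
    by apply: measurableT_comp => //; exact: measurable_coord.
  by apply/funext => p; rewrite /= mxE E.
suff -> : (fun t => rV_rcons t 0 i) = snd by exact: measurable_snd.
by apply/funext => p; rewrite mxE E.
Qed.

Definition leb_succ n (mu : {measure set 'rV[R]_n -> \bar R}) :
    set 'rV[R]_n.+1 -> \bar R :=
  pushforward (mu \x @lebesgue_measure R)%E (@rV_rcons n).

HB.instance Definition _ n (mu : {measure set 'rV[R]_n -> \bar R}) :=
  Measure.copy (leb_succ mu)
    (measure_function_pushforward__canonical__measure_function_Measure
      (mu \x @lebesgue_measure R)%E (@measurable_rV_rcons n)).

(* Lebesgue measure on the Borel sets of R^n: lambda_(n+1) is the image of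
   lambda_n \x lambda_1 under (x, t) |-> (x_1, ..., x_n, t). *)
Fixpoint leb n : {measure set 'rV[R]_n -> \bar R} :=
  if n is n'.+1 then leb_succ (leb n') else \d_(0 : 'rV[R]_0).

End lebesgue_measure_rV.

(* Functions 'rV[R]_d -> R stand for their classes modulo equality almost
   everywhere on the domain at hand; every equality between elements of the
   function spaces below is accordingly an equality almost everywhere. *)

Section sobolev.
Context (R : realType) (d : nat).
Local Notation pt := 'rV[R]_d.
Local Notation mu := (@leb R d).
Implicit Types (D : set pt) (u v w : pt -> R) (g : pt -> pt).

Definition partial (i : 'I_d) u : pt -> R := fun x => 'D_(delta_mx 0 i) u x.

Definition smooth u :=
  forall (s : seq 'I_d) x, differentiable (foldr partial u s) x.

(* C_c^oo(D) *)
Definition test_function D : set (pt -> R) :=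
  [set phi : pt -> R | smooth phi /\
    exists K, [/\ compact K, K `<=` D & forall x, ~ K x -> phi x = 0]].

Definition L2 D : set (pt -> R) :=
  [set u : pt -> R | measurable_fun D u /\
    (\int[mu]_(x in D) (u x ^+ 2)%:E < +oo)%E].

Definition is_weak_grad D u g :=
  (forall i, L2 D (fun x => g x 0 i)) /\
  forall phi, test_function D phi -> forall i,
    \int[mu]_(x in D) (u x * partial i phi x) =
    - \int[mu]_(x in D) (g x 0 i * phi x).

Definition H1 D : set (pt -> R) :=
  [set u : pt -> R | L2 D u /\ exists g, is_weak_grad D u g].

Definition wgrad D u : pt -> pt := xget (fun=> 0) [set g : pt -> pt | is_weak_grad D u g].

Definition H1norm D u : R :=
  Num.sqrt (\int[mu]_(x in D) (u x ^+ 2) +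
            \sum_(i < d) \int[mu]_(x in D) (wgrad D u x 0 i ^+ 2)).

(* the closure of C_c^oo(D) in H^1(D) *)
Definition H10 D : set (pt -> R) :=
  [set u : pt -> R | H1 D u /\ forall e : R, 0 < e ->
    exists2 phi, test_function D phi & H1norm D (fun x => u x - phi x) < e].

Definition linear_on (V : set (pt -> R)) (F : (pt -> R) -> R) :=
  forall (c : R) u v, V u -> V v ->
    F (fun x => c * u x + v x) = c * F u + F v.

(* H^-1(D), the topological dual of H^1_0(D) *)
Definition Hm1 D (f : (pt -> R) -> R) :=
  linear_on (H10 D) f /\
  exists C : R, forall v, H10 D v -> `|f v| <= C * H1norm D v.

Definition Linfty D u :=
  measurable_fun D u /\
  exists M : R, {ae mu, forall x, D x -> `|u x| <= M}.

Definition diffusion_tensor D (A : pt -> 'M[R]_d) :=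
  (forall i j, Linfty D (fun x => A x i j)) /\
  exists2 alpha : R, 0 < alpha &
    {ae mu, forall x, D x -> forall xi : 'cV[R]_d,
      alpha * (xi^T *m xi) 0 0 <= (xi^T *m A x *m xi) 0 0}.

End sobolev.

Section meshes.
Context (R : realType) (d : nat).
Local Notation pt := 'rV[R]_d.

Definition dist2 (x y : pt) : R := Num.sqrt (\sum_(i < d) (x 0 i - y 0 i) ^+ 2).

Definition diam (D : set pt) : R :=
  sup [set r | exists x y, [/\ D x, D y & r = dist2 x y]].

Definition conv_comb (I : finType) (p : I -> pt) (l : I -> R) : pt :=
  \sum_(i : I) l i *: p i.

Definition polygonal_domain (Om : set pt) :=
  [/\ open Om, connected Om, Om !=set0, bounded_set Om &
    exists (n : nat) (p : 'I_n -> 'I_d -> pt),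
      closure Om `\` Om =
      \bigcup_(k in [set: 'I_n])
        [set conv_comb (p k) l | l in [set l |
          (forall i, 0 <= l i) /\ \sum_(i < d) l i = 1]]].

(* A simplex is given by its d+1 vertices. A box-type element is given by its
   2^d vertices p S, S being the set of coordinates equal to 1 in the
   corresponding vertex of the unit cube. *)
Inductive element :=
  | Simplex of ('I_d.+1 -> pt)
  | Box of ({set 'I_d} -> pt).

Definition cube_weight (t : pt) (S : {set 'I_d}) : R :=
  \prod_(i < d) (if i \in S then t 0 i else 1 - t 0 i).

(* the multilinear map sending the vertex S of the unit cube to p S *)
Definition box_map (p : {set 'I_d} -> pt) (t : pt) : pt :=
  conv_comb p (cube_weight t).

Definition cube : set pt := [set t : pt | forall i, 0 <= t 0 i <= 1].

Definition body (e : element) : set pt :=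
  match e with
  | Simplex p => [set conv_comb p l | l in [set l |
      (forall i, 0 < l i) /\ \sum_(i < d.+1) l i = 1]]
  | Box p => [set box_map p t | t in [set t : pt | forall i, 0 < t 0 i < 1]]
  end.

Definition is_facet (e : element) (F : set pt) :=
  match e with
  | Simplex p => exists j, F = [set conv_comb p l | l in [set l |
      [/\ forall i, 0 <= l i, \sum_(i < d.+1) l i = 1 & l j = 0]]]
  | Box p => exists (i : 'I_d) (b : bool),
      F = [set box_map p t | t in [set t : pt | cube t /\ t 0 i = b%:R]]
  end.

(* The last condition makes the facets of a box-type element planar. *)
Definition nondegenerate (e : element) : Prop :=
  match e with
  | Simplex p =>
      \matrix_(k < d) (p (lift ord0 k) - p ord0) \in unitmx
  | Box p =>
      (forall s t, cube s -> cube t -> box_map p s = box_map p t -> s = t) /\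
      forall (i : 'I_d) (b : bool), exists (nu : pt) (c : R), nu != 0 /\
        forall S : {set 'I_d}, (i \in S) = b -> (nu *m (p S)^T) 0 0 = c
  end.

(* no hanging nodes: a facet lies on the boundary or is shared *)
Definition no_hanging_nodes (Om : set pt) n (elt : 'I_n -> element) :=
  forall i F, is_facet (elt i) F ->
    F `<=` closure Om `\` Om \/ exists2 j, j != i & is_facet (elt j) F.

Definition shape_regular n (elt : 'I_n -> element) :=
  exists sigma : R, forall i, exists (x : pt) (rho : R),
    [/\ 0 < rho, [set y | dist2 x y < rho] `<=` body (elt i) &
        diam (body (elt i)) <= sigma * rho].

Definition locally_quasi_uniform n (elt : 'I_n -> element) :=
  exists kappa : R, forall i j,
    closure (body (elt i)) `&` closure (body (elt j)) !=set0 ->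
    diam (body (elt i)) <= kappa * diam (body (elt j)).

Definition subdivision (Om : set pt) n (elt : 'I_n -> element) :=
  [/\ forall i, [/\ nondegenerate (elt i), open (body (elt i)) &
                    body (elt i) `<=` Om],
      forall i j, i != j -> body (elt i) `&` body (elt j) = set0 &
      closure Om = \bigcup_(i in [set: 'I_n]) closure (body (elt i))].

Definition admissible_mesh (Om : set pt) n (elt : 'I_n -> element) :=
  [/\ subdivision Om elt, no_hanging_nodes Om elt, shape_regular elt &
      locally_quasi_uniform elt].

End meshes.

Section finite_elements.
Context (R : realType) (d : nat).
Local Notation pt := 'rV[R]_d.
Local Notation mu := (@leb R d).
Context (Om : set pt) (n : nat) (elt : 'I_n -> element R d).
Local Notation T i := (body (elt i)).
Implicit Types (u v w : pt -> R) (V : set (pt -> R)).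

Variant poly_kind := TotalDegree | CoordinateDegree.

Definition poly_space (k : poly_kind) (r : nat) : set (pt -> R) :=
  [set p : pt -> R | exists c : {ffun 'I_d -> 'I_r.+1} -> R,
    (k = TotalDegree ->
      forall a : {ffun 'I_d -> 'I_r.+1}, (r < \sum_(i < d) a i)%N -> c a = 0) /\
    p = fun x => \sum_(a : {ffun 'I_d -> 'I_r.+1}) c a * \prod_(i < d) x 0 i ^+ a i].

(* V_h^r; the choice between the two polynomial spaces may depend on the
   element. *)
Definition Vh (kind : 'I_n -> poly_kind) (r : nat) : set (pt -> R) :=
  [set v : pt -> R | L2 Om v /\ forall i, exists2 p, poly_space (kind i) r p &
    v = p %[ae mu in T i]].

(* V_{h,c}^r *)
Definition Vhc kind r : set (pt -> R) := Vh kind r `&` H10 Om.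

Definition brokenH1 : set (pt -> R) := [set v : pt -> R | forall i, H1 (T i) v].

(* No particular non-conforming space is singled out: V_nc is any
   finite-dimensional linear space of elementwise H^1 functions that is not
   contained in H^1_0. *)
Definition nonconforming_space V :=
  [/\ V `<=` brokenH1 `&` L2 Om,
      V (fun=> 0) /\
        (forall (c : R) u v, V u -> V v -> V (fun x => c * u x + v x)),
      exists (m : nat) (b : 'I_m -> pt -> R), forall v, V v ->
        exists c : 'I_m -> R, v = (fun x => \sum_(k < m) c k * b k x)
          %[ae mu in Om] &
      ~ (V `<=` H10 Om)].

Definition recovery_space kind V :=
  (exists m, V = Vhc kind m) \/ nonconforming_space V.

(* A map from V_h^r to V, compatible with equality almost everywhere. *)
Definition recovery_operator kind r V (E : (pt -> R) -> (pt -> R)) :=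
  (forall v, Vh kind r v -> V (E v)) /\
  (forall v w, Vh kind r v -> Vh kind r w ->
    v = w %[ae mu in Om] -> E v = E w %[ae mu in Om]).

Definition preserves_conforming kind r (E : (pt -> R) -> (pt -> R)) :=
  forall v, Vhc kind r v -> E v = v %[ae mu in Om].

Definition stabilisation kind r (s : (pt -> R) -> (pt -> R) -> R) :=
  [/\ forall v w, Vh kind r v -> Vh kind r w -> s v w = s w v,
      forall w, Vh kind r w -> linear_on (Vh kind r) (s^~ w) &
      forall v v' w, Vh kind r v -> Vh kind r v' -> Vh kind r w ->
        v = v' %[ae mu in Om] -> s v w = s v' w].

Definition a_form (A : pt -> 'M[R]_d) w v : R :=
  \sum_(i < n) \int[mu]_(x in T i)
    (wgrad (T i) v x *m (A x *m (wgrad (T i) w x)^T)) 0 0.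

(* "int_Omega f v dx" for f in H^-1: a linear functional on the broken space
   that is the duality pairing with f on H^1_0. *)
Definition load (f ell : (pt -> R) -> R) :=
  linear_on brokenH1 ell /\ forall v, H10 Om v -> ell v = f v.

Definition solves_RFEM kind r A ell E s u :=
  Vh kind r u /\ forall v, Vh kind r v ->
    a_form A (E u) (E v) + s u v = ell (E v).

Definition solves_FEM kind r A ell u :=
  Vhc kind r u /\ forall v, Vhc kind r v -> a_form A u v = ell v.

End finite_elements.

(* Main.v *)
(* Put w := E u - u_FEM, a conforming function. Testing the R-FEM equation with w
   and the FEM equation with E w = w, where the stabilisation vanishes, gives
   a(w, w) = 0, so coercivity kills the gradient of w on every element. The
   element boundaries lie in finitely many hyperplanes, hence are null, and the
   Poincare inequality on H^1_0 yields w = 0. That elementwise weak gradients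
   are additive and agree with the global one rests on their uniqueness: bump
   functions built from exp(-1/t) converge to indicators of boxes, and boxes
   form a pi-system generating the Borel sets. *)
Require Import Defs.
From HB Require Import structures.
From mathcomp Require Import all_boot all_order all_algebra.
From mathcomp Require Import all_classical all_reals all_analysis.
From mathcomp Require Import ring lra.

Set Implicit Arguments.
Unset Strict Implicit.
Unset Printing Implicit Defensive.
Import Order.TTheory GRing.Theory Num.Theory.
Import numFieldNormedType.Exports.

Local Open Scope classical_set_scope.
Local Open Scope ring_scope.
Import measurable_realfun.

(** * Sigma-finiteness and Fubini theorems for the inductively defined Lebesgue measure *)

Section leb_fubini.
Context (R : realType).
Local Notation mu1 := (@lebesgue_measure R).

(** The hypothesis [hE_range] makes the difference [w] usable: since [E u] lies in [Vhc] of the same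
    degree [r], so does [w], which is then an admissible test function in both schemes and is fixed
    by [E] up to a null set. The obstacle is that functions stand for their classes while [wgrad] is
    picked by [xget], function by function. The gradients chosen for two almost everywhere equal
    functions, or for a difference and its two terms, are related only almost everywhere. Hence the
    lemmas speak of an arbitrary weak gradient, an explicit combination of weak gradients is shown
    to be a weak gradient again, and only then is it compared with the chosen one. Because the
    measure is built one coordinate at a time, the only calculus behind integration by parts is the
    one-variable fundamental theorem, carried to dimension [n] by Fubini and induction. The Poincare
    inequality comes from the same source, without a representation formula or a compactness
    argument. *)

Lemma rV_rcons_max n (x : 'rV[R]_n) (t : R) : rV_rcons (x, t) 0 ord_max = t.
Proof. by rewrite mxE unlift_none. Qed.

Lemma rV_rcons_lift n (x : 'rV[R]_n) (t : R) (i : 'I_n) :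
  rV_rcons (x, t) 0 (lift ord_max i) = x 0 i.
Proof. by rewrite mxE liftK. Qed.

Definition cbox n (M : R) : set 'rV[R]_n := [set x | forall i, `|x 0 i| <= M].

Lemma measurable_coord_set n (i : 'I_n) (B : set R) : measurable B ->
  measurable [set x : 'rV[R]_n | B (x 0 i)].
Proof.
by move=> mB; rewrite -[X in measurable X]setTI; exact: measurable_coord.
Qed.

Lemma measurable_forall_coord n (B : 'I_n -> set R) :
  (forall i, measurable (B i)) ->
  measurable [set x : 'rV[R]_n | forall i, B i (x 0 i)].
Proof.
move=> mB; rewrite [X in measurable X](_ : _ =
    \big[setI/setT]_(i < n) [set x : 'rV[R]_n | B i (x 0 i)]).
  by apply: bigsetI_measurable => i _; exact: measurable_coord_set.
rewrite -bigcap_seq; apply/seteqP; split => x /= h i.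
  by move=> _; exact: h.
by apply: h; rewrite /= mem_index_enum.
Qed.

Lemma measurable_cbox n (M : R) : measurable (@cbox n M).
Proof.
apply: (measurable_forall_coord (B := fun=> [set t | `|t| <= M])) => _.
rewrite [X in measurable X](_ : _ = `[- M, M]%classic) //.
by apply/seteqP; split => t /=; rewrite in_itv/= ler_norml.
Qed.

Lemma preimage_rV_rcons_cbox n (M : R) :
  @rV_rcons R n @^-1` cbox M = cbox M `*` `[- M, M]%classic.
Proof.
apply/seteqP; split => -[x t] /=.
  move=> h; split => [i /=|]; first by have := h (lift ord_max i); rewrite rV_rcons_lift.
  by rewrite in_itv/= -ler_norml; have := h ord_max; rewrite rV_rcons_max.
move=> [/= hx]; rewrite in_itv/= -ler_norml => ht i.
by case: (unliftP ord_max i) => [j|] ->; rewrite ?rV_rcons_lift ?rV_rcons_max.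
Qed.

Lemma leb_cbox_lty n (M : R) : (@leb R n (cbox M) < +oo)%E.
Proof.
elim: n M => [|n IH] M.
  by rewrite /= diracE ltry.
rewrite [X in (X < _)%E](_ : _ =
    (leb R n \x mu1)%E (cbox M `*` `[- M, M]%classic)); last first.
  by rewrite -preimage_rV_rcons_cbox.
rewrite product_measure1E//; last exact: measurable_cbox.
rewrite lte_mul_pinfty//=.
  by rewrite ge0_fin_numE.
by rewrite lebesgue_measure_itv/=; case: ifP => _; rewrite ?EFinN -?EFinD ltry.
Qed.

Lemma bigcup_cbox n : \bigcup_k @cbox n k%:R = setT.
Proof.
apply/seteqP; split => // x _.
(* The sum of the absolute values dominates each of them, so one integer serves all coordinates. *)
exists (Num.truncn (\sum_i `|x 0 i|)).+1 => //= i.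
rewrite (le_trans _ (ltW (truncnS_gt _)))//.
by rewrite (bigD1 i)//= lerDl sumr_ge0.
Qed.

Lemma leb_sigma_finite n : sigma_finite setT (@leb R n).
Proof.
exists (fun k => cbox k%:R); first by rewrite bigcup_cbox.
by move=> k; split; [exact: measurable_cbox|exact: leb_cbox_lty].
Qed.

(* A copy of [leb]: no sigma-finite instance can be keyed on [leb] itself, whose
   values are already bundled measures. *)
Definition sfleb n : set 'rV[R]_n -> \bar R := @leb R n.

HB.instance Definition _ n := Measure.copy (@sfleb n) (@leb R n).

HB.instance Definition _ n :=
  Measure_isSigmaFinite.Build _ _ _ (@sfleb n) (@leb_sigma_finite n).

Lemma lebS_prod n (X : set 'rV[R]_n.+1) :
  @leb R n.+1 X = (@sfleb n \x mu1)%E (@rV_rcons R n @^-1` X).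
Proof. by []. Qed.

Lemma leb_tonelli n (f : 'rV[R]_n.+1 -> \bar R) :
  measurable_fun [set: 'rV[R]_n.+1] f -> (forall x, 0 <= f x)%E ->
  (\int[@leb R n.+1]_x f x =
   \int[@leb R n]_x \int[mu1]_t f (rV_rcons (x, t)))%E.
Proof.
move=> mf f0.
(* [leb n.+1] is this pushforward by computation; naming it through [sfleb] brings in the
   sigma-finite instance. *)
transitivity (\int[pushforward (@sfleb n \x mu1)%E (@rV_rcons R n)]_x f x)%E.
  by [].
rewrite ge0_integral_pushforward//.
  rewrite preimage_setT.
  rewrite (@fubini_tonelli1 _ _ _ _ _ (@sfleb n) mu1 (f \o @rV_rcons R n)).
  - by [].
  - by apply: measurableT_comp => //; exact: measurable_rV_rcons.
  - by move=> x; exact: f0.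
exact: measurable_rV_rcons.
Qed.

Lemma leb_integrable_rcons n (f : 'rV[R]_n.+1 -> \bar R) :
  (@leb R n.+1).-integrable [set: 'rV[R]_n.+1] f ->
  (@sfleb n \x mu1)%E.-integrable setT (f \o @rV_rcons R n).
Proof.
move=> /integrableP[mf fi]; apply/integrableP; split.
  by apply: measurableT_comp => //; exact: measurable_rV_rcons.
move: fi; rewrite leb_tonelli//; last exact: measurableT_comp.
rewrite (@fubini_tonelli1 _ _ _ _ _ (@sfleb n) mu1 (abse \o f \o @rV_rcons R n)).
- by [].
- apply: measurableT_comp; first exact: measurableT_comp.
  exact: measurable_rV_rcons.
- by move=> x; exact: abse_ge0.
Qed.

Lemma leb_fubini n (f : 'rV[R]_n.+1 -> \bar R) :
  (@leb R n.+1).-integrable [set: 'rV[R]_n.+1] f ->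
  (\int[@leb R n.+1]_x f x =
   \int[@leb R n]_x \int[mu1]_t f (rV_rcons (x, t)))%E.
Proof.
move=> fi; have fi' := leb_integrable_rcons fi.
transitivity (\int[pushforward (@sfleb n \x mu1)%E (@rV_rcons R n)]_x f x)%E.
  by [].
rewrite integral_pushforward//.
- by rewrite preimage_setT -(integral12_prod_meas1 fi').
- exact: measurable_rV_rcons.
- exact: measurable_int fi.
Qed.

Lemma leb_fubini_sym n (f : 'rV[R]_n.+1 -> \bar R) :
  (@leb R n.+1).-integrable [set: 'rV[R]_n.+1] f ->
  (\int[@leb R n.+1]_x f x =
   \int[mu1]_t \int[@leb R n]_x f (rV_rcons (x, t)))%E.
Proof.
move=> fi; have fi' := leb_integrable_rcons fi.
by rewrite leb_fubini// -(Fubini fi').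
Qed.

End leb_fubini.

(** * Boxes, Borel sets and compactness in R^n *)

Section rV_topology.
Context (R : realType).
Local Notation mu1 := (@lebesgue_measure R).

Lemma continuous_rV n (T : topologicalType) (f : T -> 'rV[R]_n) :
  (forall i, continuous (fun t => f t 0 i)) -> continuous f.
Proof.
move=> cf t A [P hP sA]; apply: (filterS sA) => /=.
apply: filter_forall => i; apply: filter_forall => j.
by rewrite (ord1 i) in hP *; apply: cf; exact: hP.
Qed.

Lemma nbhs_rVP n (x : 'rV[R]_n) (A : set 'rV[R]_n) : nbhs x A ->
  exists2 e : R, 0 < e & forall y : 'rV[R]_n, (forall i, `|x 0 i - y 0 i| < e) -> A y.
Proof.
move=> /nbhs_ballP[e /= e0 sA]; exists e => // y hy; apply: sA.
by split => // i j; rewrite (ord1 i); exact: hy.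
Qed.

Definition obox n (a b : 'rV[R]_n) : set 'rV[R]_n :=
  [set x | forall i, a 0 i < x 0 i < b 0 i].

Definition kbox n (a b : 'rV[R]_n) : set 'rV[R]_n :=
  [set x | forall i, a 0 i <= x 0 i <= b 0 i].

Definition oboxes n : set (set 'rV[R]_n) := [set obox ab.1 ab.2 | ab in setT].

(** Only boxes whose closed hull lies in [U] are kept, since they will have to carry test functions,
    supported in a compact subset of the domain. Rational corners keep the union countable. *)
Lemma bigcup_rat_obox n (U : set 'rV[R]_n) : open U ->
  U = \bigcup_(p in [set p : 'rV[rat]_n * 'rV[rat]_n |
         kbox (map_mx ratr p.1) (map_mx ratr p.2) `<=` U])
        obox (map_mx ratr p.1) (map_mx ratr p.2).
Proof.
move=> oU; apply/seteqP; split => [x Ux|x [p /= pU] xp]; last first.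
  by apply: pU => i; have /andP[/ltW -> /ltW ->] := xp i.
have [e e0 eU] := nbhs_rVP (open_nbhs_nbhs (conj oU Ux)).
have /(_ _)/cid2-/all_sig2[q1 _ q1P] : forall i : 'I_n, exists2 q : rat, True &
    ratr q \in `]x 0 i - e, x 0 i[.
  by move=> i; have [|q] := @rat_in_itvoo R (x 0 i - e) (x 0 i); [lra|exists q].
have /(_ _)/cid2-/all_sig2[q2 _ q2P] : forall i : 'I_n, exists2 q : rat, True &
    ratr q \in `]x 0 i, x 0 i + e[.
  by move=> i; have [|q] := @rat_in_itvoo R (x 0 i) (x 0 i + e); [lra|exists q].
exists (\row_i q1 i, \row_i q2 i) => /=.
  move=> y hy; apply: eU => i; have := hy i; rewrite !mxE.
  have := q1P i; have := q2P i; rewrite !in_itv/= ltr_norml => ? ? ?; lra.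
move=> i; rewrite !mxE.
by have := q1P i; have := q2P i; rewrite !in_itv/= => ? ?; lra.
Qed.

Lemma open_sigma_oboxes n (U : set 'rV[R]_n) : open U -> <<s @oboxes n >> U.
Proof.
move=> /bigcup_rat_obox ->; rewrite bigcup_mkcond.
apply: (@countable_bigcupT_measurable _ (g_sigma_algebraType (@oboxes n))).
  exact: countableP.
move=> p; case: ifP => // _; apply: sub_sigma_algebra.
by exists (map_mx ratr p.1, map_mx ratr p.2).
Qed.

Lemma measurable_obox n (a b : 'rV[R]_n) : measurable (obox a b).
Proof.
apply: (measurable_forall_coord (B := fun i => `]a 0 i, b 0 i[%classic)).
by move=> i; exact: measurable_itv.
Qed.

Lemma measurable_open_rV n (U : set 'rV[R]_n) : open U -> measurable U.
Proof.
move=> /open_sigma_oboxes; apply: smallest_sub.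
  exact: sigma_algebra_measurable.
by move=> _ [[a b] _ <-]; exact: measurable_obox.
Qed.

(** Lets the Dynkin argument on boxes reach every Borel set: each coordinate map is measurable for
    the sigma-algebra of boxes, because preimages of open intervals are open. *)
Lemma measurable_sigma_oboxes n (A : set 'rV[R]_n) :
  measurable A -> <<s @oboxes n >> A.
Proof.
apply: smallest_sub; first exact: smallest_sigma_algebra.
rewrite -bigcup_seq => _ [i _] [B mB <-].
have : measurable_fun [set: g_sigma_algebraType (@oboxes n)]
    (fun x : g_sigma_algebraType (@oboxes n) => (x : 'rV[R]_n) 0 i).
  apply: (measurability _ (RGenOpens.measurableE R)).
  move=> _ [_ [a [b ->] <-]]; rewrite setTI; apply: open_sigma_oboxes.
  move/continuousP : (@coord_continuous R 1 n 0 i); apply.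
  exact: interval_open.
by apply.
Qed.

Lemma continuous_measurable_rV n (f : 'rV[R]_n -> R) :
  continuous f -> measurable_fun setT f.
Proof.
move=> /continuousP cf; apply: (measurability _ (RGenOpens.measurableE R)).
move=> _ [_ [a [b ->] <-]]; rewrite setTI; apply: measurable_open_rV.
exact/cf/interval_open.
Qed.

Lemma cbox_compact n (M : R) : compact (@cbox R n M).
Proof.
have /= := @rV_compact R n (fun=> `[- M, M]%classic) (fun=> @segment_compact _ _ _).
congr compact; apply/seteqP; split => x /= h i; have := h i;
  by rewrite in_itv/= ler_norml.
Qed.

Lemma closed_cbox n (M : R) : closed (@cbox R n M).
Proof. by apply: compact_closed => //; exact: cbox_compact. Qed.

Lemma bounded_sub_cbox n (D : set 'rV[R]_n) : bounded_set D ->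
  exists2 M : R, 0 < M & D `<=` cbox M.
Proof.
(* Every number above [M0] is a bound; [M0] may be negative, and a positive bound is wanted. *)
move=> [M0 [_ h]]; exists (`|M0| + 1); first by rewrite ltr_wpDl.
move=> x Dx i; have /= := h (`|M0| + 1) _ x Dx.
have lt : M0 < `|M0| + 1 by rewrite (le_lt_trans (ler_norm _))// ltrDl.
move=> /(_ lt); apply: le_trans; rewrite [leRHS]/Num.norm/= mx_normrE.
exact: (@le_bigmax _ _ _ 0 (fun ij : 'I_1 * 'I_n => `|x ij.1 ij.2|) (0, i)).
Qed.

Lemma bounded_measure_lty n (D : set 'rV[R]_n) :
  measurable D -> bounded_set D -> (@leb R n D < +oo)%E.
Proof.
move=> mD /bounded_sub_cbox[M _ DM].
apply: le_lt_trans (@leb_cbox_lty R n M).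
by apply: le_measure => //; rewrite inE//; exact: measurable_cbox.
Qed.

Lemma integrable_bounded_support n (f : 'rV[R]_n -> R) (M C : R) :
  measurable_fun setT f -> (forall x, `|f x| <= C) ->
  (forall x, ~ cbox M x -> f x = 0) ->
  (@leb R n).-integrable setT (EFin \o f).
Proof.
move=> mf fC f0.
have -> : EFin \o f = (EFin \o f) \_ (cbox M).
  apply/funext => x; rewrite patchE; case: ifPn => //.
  by rewrite notin_setE => /f0 /= ->.
apply/integrable_restrict => //; first exact: measurable_cbox.
rewrite setTI; apply: measurable_bounded_integrable.
- exact: measurable_cbox.
- exact: leb_cbox_lty.
- exact: measurable_funTS.
- by exists C; split; [exact: num_real|move=> y Cy x _ /=; exact: le_trans (fC x) (ltW Cy)].
Qed.

End rV_topology.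

(** * The integral of a partial derivative with bounded support vanishes *)

Section integral_partial.
Context (R : realType).
Local Notation mu1 := (@lebesgue_measure R).

Lemma integral_derive1_eq0 (g : R -> R) (M : R) :
  (forall t, derivable g t 1) -> continuous (derive1 g) ->
  (forall t, M < `|t| -> g t = 0) ->
  (\int[mu1]_t (derive1 g t)%:E = 0)%E.
Proof.
move=> dg cg g0.
have g'0 t : M < `|t| -> derive1 g t = 0.
  move=> Mt; rewrite derive1E.
  have -> : 'D_1 g t = 'D_1 (cst 0 : R -> R) t.
    apply: near_eq_derive.
    have : \forall s \near t, M < `|s|.
      exact: (cvgr_gt `|t| (@norm_continuous _ _ t)).
    by apply: filterS => s /g0.
  exact: derive_cst.
(* The endpoints [- b] and [b] lie strictly outside the support, so both boundary terms are 0. *)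
pose b : R := `|M| + 1; have b0 : 0 < b by rewrite ltr_wpDl.
have Mb : M < b by rewrite (le_lt_trans (ler_norm _))// ltrDl.
transitivity (\int[mu1]_(t in `[(- b)%R, b%R]) (derive1 g t)%:E)%E.
  rewrite [RHS]integral_mkcond; apply: eq_integral => t _.
  rewrite patchE; case: ifPn => //; rewrite notin_setE/= in_itv/= => /negP.
  by rewrite -ler_norml -ltNge => tb; rewrite g'0// (lt_trans Mb).
have cgg : continuous g.
  by move=> t; apply: differentiable_continuous; exact/derivable1_diffP.
rewrite (@continuous_FTC2 _ _ g); first by rewrite !g0 ?subee ?normrN ?gtr0_norm.
- by rewrite gtrN.
- exact: continuous_subspaceT.
- split; first by move=> x _; exact: dg.
    by apply: cvg_at_right_filter; exact: cgg.
  by apply: cvg_at_left_filter; exact: cgg.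
- by move=> x _.
Qed.

Lemma rV_rconsDl n (x : 'rV[R]_n) (t h : R) (i : 'I_n) :
  rV_rcons (h *: delta_mx 0 i + x, t) =
  h *: delta_mx 0 (lift ord_max i) + rV_rcons (x, t).
Proof.
apply/rowP => j; rewrite [RHS]mxE [in RHS]mxE.
case: (unliftP ord_max j) => [k|] ->.
  rewrite !rV_rcons_lift 2!mxE; congr (h * _ + _).
  by rewrite !mxE (inj_eq lift_inj).
by rewrite !rV_rcons_max [in RHS]mxE eqxx (negPf (neq_lift _ _)) mulr0 add0r.
Qed.

Lemma rV_rconsDr n (x : 'rV[R]_n) (t h : R) :
  rV_rcons (x, h * 1 + t) = h *: delta_mx 0 ord_max + rV_rcons (x, t).
Proof.
apply/rowP => j; rewrite [RHS]mxE [in RHS]mxE.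
case: (unliftP ord_max j) => [k|] ->.
  by rewrite !rV_rcons_lift [in RHS]mxE eqxx eq_sym (negPf (neq_lift _ _)) mulr0 add0r.
by rewrite !rV_rcons_max mxE !eqxx.
Qed.

(** The difference quotients of [F] and of its slice are the same function of [h], so derivability
    and derivatives transfer by rewriting, with no chain rule. *)
Lemma rV_rcons_line_lift n (F : 'rV[R]_n.+1 -> R) (x : 'rV[R]_n) t i :
  (fun h : R => h^-1 *: ((F (rV_rcons (h *: delta_mx 0 i + x, t))) -
     F (rV_rcons (x, t)))) =
  (fun h : R => h^-1 *: ((F (h *: delta_mx 0 (lift ord_max i) +
     rV_rcons (x, t))) - F (rV_rcons (x, t)))).
Proof. by apply/funext => h; rewrite rV_rconsDl. Qed.

Lemma derivable_rV_rcons_lift n (F : 'rV[R]_n.+1 -> R) (x : 'rV[R]_n) t i :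
  derivable F (rV_rcons (x, t)) (delta_mx 0 (lift ord_max i)) ->
  derivable (fun y => F (rV_rcons (y, t))) x (delta_mx 0 i).
Proof. by rewrite /derivable /= rV_rcons_line_lift. Qed.

Lemma partial_rV_rcons_lift n (F : 'rV[R]_n.+1 -> R) (x : 'rV[R]_n) t i :
  partial i (fun y => F (rV_rcons (y, t))) x =
  partial (lift ord_max i) F (rV_rcons (x, t)).
Proof. by rewrite /partial /derive /= rV_rcons_line_lift. Qed.

Lemma rV_rcons_line_max n (F : 'rV[R]_n.+1 -> R) (x : 'rV[R]_n) t :
  (fun h : R => h^-1 *: ((F (rV_rcons (x, h * 1 + t))) -
     F (rV_rcons (x, t)))) =
  (fun h : R => h^-1 *: ((F (h *: delta_mx 0 ord_max +
     rV_rcons (x, t))) - F (rV_rcons (x, t)))).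
Proof. by apply/funext => h; rewrite rV_rconsDr. Qed.

Lemma derivable_rV_rcons_max n (F : 'rV[R]_n.+1 -> R) (x : 'rV[R]_n) t :
  derivable F (rV_rcons (x, t)) (delta_mx 0 ord_max) ->
  derivable (fun s => F (rV_rcons (x, s))) t 1.
Proof. by rewrite /derivable /= rV_rcons_line_max. Qed.

Lemma partial_rV_rcons_max n (F : 'rV[R]_n.+1 -> R) (x : 'rV[R]_n) t :
  derive1 (fun s => F (rV_rcons (x, s))) t = partial ord_max F (rV_rcons (x, t)).
Proof. by rewrite derive1E /partial /derive /= rV_rcons_line_max. Qed.

Lemma continuous_rV_rconsl n (t : R) :
  continuous (fun x : 'rV[R]_n => rV_rcons (x, t)).
Proof.
apply: continuous_rV => i.
case: (unliftP ord_max i) => [k|] ->.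
  under [X in continuous X]eq_fun do rewrite rV_rcons_lift.
  exact: coord_continuous.
under [X in continuous X]eq_fun do rewrite rV_rcons_max.
exact: cst_continuous.
Qed.

Lemma continuous_rV_rconsr n (x : 'rV[R]_n) :
  continuous (fun t : R => rV_rcons (x, t)).
Proof.
apply: continuous_rV => i.
case: (unliftP ord_max i) => [k|] ->.
  under [X in continuous X]eq_fun do rewrite rV_rcons_lift.
  exact: cst_continuous.
under [X in continuous X]eq_fun do rewrite rV_rcons_max.
by move=> s; apply: cvg_id.
Qed.

Lemma partial_eq0 n (K : set 'rV[R]_n) (F : 'rV[R]_n -> R) (i : 'I_n) :
  closed K -> (forall x, ~ K x -> F x = 0) ->
  forall x, ~ K x -> partial i F x = 0.
Proof.
move=> cK F0 x nx; rewrite /partial.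
have -> : 'D_(delta_mx 0 i) F x = 'D_(delta_mx 0 i) (cst 0 : 'rV[R]_n -> R) x.
  apply: near_eq_derive.
  have : \forall y \near x, (~` K) y.
    by apply: open_nbhs_nbhs; split => //; rewrite openC.
  by apply: filterS => y /F0.
exact: derive_cst.
Qed.

Lemma continuous_bounded_support n (F : 'rV[R]_n -> R) (M : R) :
  continuous F -> (forall x, ~ cbox M x -> F x = 0) ->
  exists C, forall x, `|F x| <= C.
Proof.
move=> cF F0.
have /compact_bounded[C [_ hC]] : compact (F @` cbox M).
  apply: continuous_compact; last exact: cbox_compact.
  exact: continuous_subspaceT.
exists (`|C| + 1) => x; have [xM|/F0 ->] := pselect (cbox M x); last first.
  by rewrite normr0 addr_ge0.
apply: (hC (`|C| + 1)); first by rewrite (le_lt_trans (ler_norm _))// ltrDl.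
by exists x.
Qed.

Lemma integrable_continuous_support n (F : 'rV[R]_n -> R) (M : R) :
  continuous F -> (forall x, ~ cbox M x -> F x = 0) ->
  (@leb R n).-integrable setT (EFin \o F).
Proof.
move=> cF F0; have [C hC] := continuous_bounded_support cF F0.
exact: (integrable_bounded_support (continuous_measurable_rV cF) hC F0).
Qed.

(** Induction on the dimension. In the last coordinate the inner integral vanishes by the
    fundamental theorem; for another coordinate Fubini freezes the last variable and the induction
    hypothesis applies to the slice. Regularity is asked in direction [i] only, and slices inherit
    it together with the bound [M]. *)
Lemma integral_partial_eq0 n (F : 'rV[R]_n -> R) (i : 'I_n) (M : R) :
  (forall x, derivable F x (delta_mx 0 i)) -> continuous (partial i F) ->
  (forall x, ~ cbox M x -> F x = 0) ->
  (\int[@leb R n]_x (partial i F x)%:E = 0)%E.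
Proof.
elim: n F i => [|n IH] F i dF cF F0; first by case: i dF cF => -[].
have iF := integrable_continuous_support cF (partial_eq0 i (@closed_cbox _ _ _) F0).
case: (unliftP ord_max i) dF cF iF => [k|] -> dF cF iF.
  rewrite (leb_fubini_sym iF); apply: integral0_eq => t _.
  have := IH (fun y => F (rV_rcons (y, t))) k.
  have -> : partial k (fun y => F (rV_rcons (y, t))) =
      fun y => partial (lift ord_max k) F (rV_rcons (y, t)).
    by apply/funext => y; rewrite partial_rV_rcons_lift.
  apply=> [x|x|x nx].
  - exact: derivable_rV_rcons_lift.
  - by apply: continuous_comp; [exact: continuous_rV_rconsl|exact: cF].
  - apply: F0 => h; apply: nx => j.
    by have := h (lift ord_max j); rewrite rV_rcons_lift.
rewrite (leb_fubini iF); apply: integral0_eq => x _.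
have := @integral_derive1_eq0 (fun s => F (rV_rcons (x, s))) M.
have -> : derive1 (fun s => F (rV_rcons (x, s))) =
    fun s => partial ord_max F (rV_rcons (x, s)).
  by apply/funext => s; rewrite partial_rV_rcons_max.
apply=> [t|t|t nt].
- exact: derivable_rV_rcons_max.
- by apply: continuous_comp; [exact: continuous_rV_rconsr|exact: cF].
- apply: F0 => /(_ ord_max); rewrite rV_rcons_max.
  by rewrite leNgt nt.
Qed.

End integral_partial.

(** * Smooth functions that are flat at the origin *)

Section flat.
Context (R : realType).
Implicit Types (p : {poly R}) (y z : R).

(* The family of functions [p(1/y) exp(-1/y)] on [y > 0], extended by [0]: it
   is closed under derivation, which makes each of its members smooth. *)
Definition flat p y : R :=
  if 0 < y then p.[y^-1] * expR (- y^-1) else 0.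

(** Raise [y <= expR y], taken at [y = z / m], to the power [m]. The division forces a separate case
    [m = 0]. *)
Lemma pow_expRN_le (m : nat) z : 0 < z -> z ^+ m * expR (- z) <= m%:R ^+ m.
Proof.
move=> z0; rewrite expRN ler_pdivrMr ?expR_gt0//.
case: m => [|m]; first by rewrite !expr0 mul1r ltW// expR_gt1.
have -> : z = m.+1%:R * (z / m.+1%:R) by rewrite mulrC divfK.
rewrite expRM_natl -exprMn lerXn2r ?nnegrE ?mulr_ge0 ?divr_ge0 ?expR_ge0 ?ltW//.
by rewrite ltr_pM2l ?ltr0n//; apply: lt_le_trans (expR_ge1Dx _); rewrite ltrDr.
Qed.

(** The extra power of [z] carries the induction: passing from [p] to [p * 'X + c] trades the
    exponent [m] for [m.+1]. *)
Lemma horner_expRN_bounded p (m : nat) : exists2 C, 0 <= C &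
  forall z, 0 < z -> `|p.[z]| * z ^+ m * expR (- z) <= C.
Proof.
elim/poly_ind: p m => [|p c IH] m.
  by exists 0 => // z z0; rewrite horner0 normr0 !mul0r.
have [C C0 hC] := IH m.+1.
exists (C + `|c| * m%:R ^+ m); first by rewrite addr_ge0 ?mulr_ge0 ?exprn_ge0.
move=> z z0; rewrite hornerMXaddC.
have z1 : 0 <= z ^+ m * expR (- z) by rewrite mulr_ge0 ?exprn_ge0 ?expR_ge0 ?ltW.
apply: (@le_trans _ _ ((`|p.[z] * z| + `|c|) * (z ^+ m * expR (- z)))).
  by rewrite -mulrA ler_wpM2r// ler_normD.
rewrite mulrDl lerD//; last by rewrite ler_wpM2l// pow_expRN_le.
by apply: le_trans (hC _ z0); rewrite normrM (gtr0_norm z0) exprS !mulrA.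
Qed.

(** Exponent 2 at [z = y^-1]. A quadratic bound is what makes the difference quotient at 0 tend to
    0. *)
Lemma flat_le_sqr p : exists2 C, 0 <= C & forall y, `|flat p y| <= C * y ^+ 2.
Proof.
have [C C0 hC] := horner_expRN_bounded p 2; exists C => // y.
rewrite /flat; case: ifPn => y0; last by rewrite normr0 mulr_ge0// sqr_ge0.
rewrite -ler_pdivrMr ?exprn_gt0//.
apply: le_trans (hC y^-1 _); last by rewrite invr_gt0.
by rewrite normrM (ger0_norm (expR_ge0 _)) exprVn mulrAC.
Qed.

(** For [y > 0] the factor ['X^2] is the [y^-2] common to the derivatives of [p.[y^-1]] and of
    [expR (- y^-1)]. For [y < 0] the function is locally 0, and at 0 the quadratic bound decides. *)
Lemma is_derive_flat p y :
  is_derive y 1 (flat p) (flat ('X^2 * (p - deriv p)) y).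
Proof.
have [y0|y0|<-] := ltgtP 0 y.
- rewrite {2}/flat y0.
  have : is_derive y 1 (fun y => p.[y^-1] * expR (- y^-1))
      (p.[y^-1] *: (expR (- y^-1) * (- (- y ^- 2 *: 1))) +
       expR (- y^-1) *: ((deriv p).[y^-1] * (- y ^- 2 *: 1))).
    have dV : is_derive y 1 (fun y : R => y^-1) (- y ^- 2 *: 1).
      by apply: is_deriveV; rewrite gt_eqF.
    exact: (@is_deriveM _ _ (fun y => p.[y^-1]) (fun y => expR (- y^-1))).
  have -> : p.[y^-1] *: (expR (- y^-1) * (- (- y ^- 2 *: 1))) +
       expR (- y^-1) *: ((deriv p).[y^-1] * (- y ^- 2 *: 1)) =
      ('X^2 * (p - deriv p)).[y^-1] * expR (- y^-1).
    rewrite !hornerE /GRing.scale/= exprVn; ring.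
  apply: near_eq_is_derive.
  have : \forall z \near y, 0 < z by exact: lt_nbhsr.
  by apply: filterS => z z0; rewrite /flat z0.
- rewrite {2}/flat ltNge (ltW y0)/=.
  apply: (near_eq_is_derive _ (is_derive_cst (0 : R) y 1)).
  have : \forall z \near y, z < 0 by exact: lt_nbhsl.
  by apply: filterS => z z0; rewrite /flat ltNge (ltW z0).
- rewrite {2}/flat ltxx.
  have [C C0 hC] := flat_le_sqr p.
  have cv : (h^-1 *: ((flat p \o shift 0) (h *: 1) - flat p 0)) @[h --> 0^'] -->
      (0 : R).
    apply/cvgr0Pnorm_lt => e e0.
    (* [C] may be 0, hence the denominator [C + 1]. *)
    have e1 : 0 < e / (C + 1) by rewrite divr_gt0// ltr_wpDl.
    exists (e / (C + 1)) => //= h; rewrite /ball/= sub0r normrN => he h0.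
    rewrite /shift/= addr0 [h *: 1]mulr1 {2}/flat ltxx subr0.
    rewrite normrZ normfV ltr_pdivrMl ?normr_gt0//.
    apply: le_lt_trans (hC h) _.
    rewrite -[h ^+ 2]ger0_norm ?sqr_ge0// normrX expr2 mulrA mulrC ltr_pM2l ?normr_gt0//.
    move: he; rewrite ltr_pdivlMr ?ltr_wpDl// => /le_lt_trans; apply.
    by rewrite mulrC ler_wpM2l// lerDl.
  apply: DeriveDef; first by apply/cvg_ex; exists 0.
  by apply: cvg_lim.
Qed.

Lemma flat1_ge0 y : 0 <= flat 1 y.
Proof. by rewrite /flat; case: ifP => // _; rewrite hornerE mul1r expR_ge0. Qed.

Lemma flat1_le1 y : flat 1 y <= 1.
Proof.
rewrite /flat; case: ifP => // y0.
by rewrite hornerE mul1r -[leRHS]expR0 ler_expR oppr_le0 invr_ge0 ltW.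
Qed.

Lemma flat_le0 p y : y <= 0 -> flat p y = 0.
Proof. by rewrite /flat leNgt => /negbTE ->. Qed.

Lemma cvg_flat1_scale y : 0 < y -> flat 1 (k.+1%:R * y) @[k --> \oo] --> (1 : R).
Proof.
move=> y0; rewrite -[X in _ --> X]expR0 -[X in expR X](mulr0 (- y^-1)).
rewrite (_ : (fun k => _) = (fun k => expR (- y^-1 * k.+1%:R^-1))); last first.
  apply/funext => k; rewrite /flat mulr_gt0// hornerE mul1r invfM.
  by rewrite mulNr mulrC.
apply: continuous_cvg; first exact: continuous_expR.
by apply: cvgM; [exact: cvg_cst|exact: cvg_harmonic].
Qed.

End flat.

(** * Test functions approximating indicators of boxes *)

Section bumps.
Context (R : realType) (d : nat).
Local Notation pt := 'rV[R]_d.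

(** A class of differentiable functions stable under every [partial]: smoothness of all orders then
    needs no formula for iterated derivatives. *)
Inductive flat_poly : (pt -> R) -> Prop :=
| flat_poly_cst c : flat_poly (cst c)
| flat_poly_flat p k a i : flat_poly (fun x => flat p (k * x 0 i + a))
| flat_polyD f g : flat_poly f -> flat_poly g -> flat_poly (f + g)
| flat_polyM f g : flat_poly f -> flat_poly g -> flat_poly (f * g).

Lemma is_derive_coord (x v : pt) (i : 'I_d) :
  is_derive x v (fun y : pt => y 0 i) (v 0 i).
Proof.
apply: DeriveDef; first exact/diff_derivable/differentiable_coord.
rewrite deriveE; last exact: differentiable_coord.
(* The coordinate is packaged as a linear map, which is its own differential. *)
have @f : {linear pt -> R}.
  by exists (fun N : pt => N 0 i); do 2![eexists]; do ?[constructor];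
     rewrite ?mxE// => ? *; rewrite ?mxE//; move=> ?; rewrite !mxE.
rewrite (_ : (fun _ => _) = f) // diff_lin//; exact: coord_continuous.
Qed.

Lemma is_derive_affine_coord (x v : pt) (i : 'I_d) (k a : R) :
  is_derive x v (fun y : pt => k * y 0 i + a) (k * v 0 i).
Proof.
have d1 := is_derive_coord x v i.
have := is_deriveD (is_deriveZ k d1) (is_derive_cst a x v).
by rewrite addr0.
Qed.

Lemma differentiable_affine_coord (x : pt) (i : 'I_d) (k a : R) :
  differentiable (fun y : pt => k * y 0 i + a) x.
Proof.
apply: differentiableD; last exact: differentiable_cst.
by apply: (@differentiableZ _ _ _ (fun y : pt => y 0 i)); exact: differentiable_coord.
Qed.

Lemma differentiable_flat p (y : R) : differentiable (@flat R p) y.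
Proof.
by apply/derivable1_diffP; have [] := is_derive_flat p y.
Qed.

Lemma flat_poly_differentiable f x : flat_poly f -> differentiable f x.
Proof.
elim=> [c|p k a i|g h _ dg _ dh|g h _ dg _ dh].
- exact: differentiable_cst.
- apply: (@differentiable_comp _ _ _ _ (fun y : pt => k * y 0 i + a) (flat p)).
    exact: differentiable_affine_coord.
  exact: differentiable_flat.
- exact: differentiableD.
- exact: differentiableM.
Qed.

Lemma flat_poly_partial f i : flat_poly f -> flat_poly (partial i f).
Proof.
elim=> [c|p k a j|g h fg dg fh dh|g h fg dg fh dh].
- rewrite (_ : partial i _ = cst 0); first exact: flat_poly_cst.
  by apply/funext => x; rewrite /partial derive_cst.
- rewrite (_ : partial i _ = cst (k * (delta_mx 0 i : pt) 0 j) *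
      (fun x : pt => flat ('X^2 * (p - deriv p)) (k * x 0 j + a))).
    by apply: flat_polyM; [exact: flat_poly_cst|exact: flat_poly_flat].
  apply/funext => x; rewrite /partial deriveE; last first.
    exact: (flat_poly_differentiable _ (flat_poly_flat _ _ _ _)).
  rewrite (@diff_comp _ _ _ _ (fun y : pt => k * y 0 j + a) (flat p)); last 2 first.
  - exact: differentiable_affine_coord.
  - exact: differentiable_flat.
  have dA : 'd (fun y : pt => k * y 0 j + a) x (delta_mx 0 i) =
      k * (delta_mx 0 i : pt) 0 j.
    rewrite -deriveE; last exact: differentiable_affine_coord.
    by have [_ ->] := is_derive_affine_coord x (delta_mx 0 i) j k a.
  rewrite [LHS]/= dA.
  rewrite diff1E; last exact: differentiable_flat.
  by rewrite derive1E; have [_ ->] := is_derive_flat p (k * x 0 j + a).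
- rewrite (_ : partial i _ = partial i g + partial i h); first exact: flat_polyD.
  apply/funext => x; rewrite /partial deriveD//;
    exact/diff_derivable/flat_poly_differentiable.
- rewrite (_ : partial i _ = g * partial i h + h * partial i g).
    by apply: flat_polyD; exact: flat_polyM.
  apply/funext => x; rewrite /partial deriveM//;
    exact/diff_derivable/flat_poly_differentiable.
Qed.

Lemma flat_poly_smooth f : flat_poly f -> smooth f.
Proof.
move=> ff s x; apply: flat_poly_differentiable.
by elim: s => //= i s; exact: flat_poly_partial.
Qed.

(** The support stays in one closed box for all [k]; the factor [k.+1] only steepens the edges, so
    that the values inside increase to 1. *)
Definition bump (a b : pt) (k : nat) : pt -> R := fun x =>
  \prod_(i < d) (flat 1 (k.+1%:R * (x 0 i - a 0 i)) *
                 flat 1 (k.+1%:R * (b 0 i - x 0 i))).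

Lemma bump_smooth a b k : smooth (bump a b k).
Proof.
apply: flat_poly_smooth.
(* Each argument is brought to the affine form [k * x 0 i + a] of the constructor
   [flat_poly_flat]. *)
rewrite (_ : bump a b k = \big[*%R/cst 1]_(i < d)
    ((fun x : pt => flat 1 (k.+1%:R * x 0 i + - (k.+1%:R * a 0 i))) *
     (fun x : pt => flat 1 (- k.+1%:R * x 0 i + k.+1%:R * b 0 i)))).
  elim/big_ind: _ => [|f g|i _]; first exact: flat_poly_cst.
    exact: flat_polyM.
  by apply: flat_polyM; exact: flat_poly_flat.
apply/funext => x; rewrite /bump.
elim/big_rec2: _ => //= i f _ _ ->.
rewrite [RHS](_ : _ = flat 1 (k.+1%:R * x 0 i + - (k.+1%:R * a 0 i)) *
  flat 1 (- k.+1%:R * x 0 i + k.+1%:R * b 0 i) * f x)//.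
by congr (flat 1 _ * flat 1 _ * _); ring.
Qed.

Lemma bump_ge0 a b k x : 0 <= bump a b k x.
Proof. by apply: prodr_ge0 => i _; rewrite mulr_ge0 ?flat1_ge0. Qed.

Lemma bump_le1 a b k x : bump a b k x <= 1.
Proof.
apply: prodr_ile1 => i _; rewrite mulr_ge0 ?flat1_ge0//=.
by rewrite -[leRHS]mul1r ler_pM ?flat1_ge0 ?flat1_le1.
Qed.

Lemma bump_out a b k x : ~ obox a b x -> bump a b k x = 0.
Proof.
move=> /existsNP[i /negP]; rewrite negb_and -!leNgt => hi.
rewrite /bump (bigD1 i)//=.
case/orP: hi => h; first rewrite (@flat_le0 _ _ (_ * (x 0 i - _))) ?mul0r//.
  by rewrite mulr_ge0_le0// subr_le0.
rewrite (@flat_le0 _ _ (_ * (b 0 i - _))) ?mulr0 ?mul0r//.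
by rewrite mulr_ge0_le0// subr_le0.
Qed.

Lemma cvg_bump a b x : bump a b k x @[k --> \oo] --> (\1_(obox a b) x : R).
Proof.
have [xin|xout] := pselect (obox a b x); last first.
  rewrite indicE memNset//.
  under eq_fun do rewrite bump_out//.
  exact: cvg_cst.
have -> : \1_(obox a b) x = \prod_(i < d) (1 : R).
  by rewrite big1// indicE mem_set.
apply: cvg_big => [|i _].
  by move=> z; exact: mul_continuous.
have /andP[ax xb] := xin i.
rewrite -[X in _ --> X](mulr1 1); apply: cvgM; apply: cvg_flat1_scale.
  by rewrite subr_gt0.
by rewrite subr_gt0.
Qed.

Lemma compact_kbox (a b : pt) : compact (kbox a b).
Proof.
have /= := @rV_compact R d (fun i => `[a 0 i, b 0 i]%classic) (fun=> @segment_compact _ _ _).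
by congr compact; apply/seteqP; split => x /= h i; have := h i; rewrite in_itv.
Qed.

Lemma bump_test_function (D : set pt) a b k : kbox a b `<=` D ->
  test_function D (bump a b k).
Proof.
move=> abD; split; first exact: bump_smooth.
exists (kbox a b); split=> //; first exact: compact_kbox.
move=> x nx; apply: bump_out => h; apply: nx => i.
by have /andP[/ltW -> /ltW ->] := h i.
Qed.

End bumps.

(** * The fundamental lemma of the calculus of variations *)

Section fundamental_lemma.
Context (R : realType) (d : nat).
Local Notation pt := 'rV[R]_d.
Local Notation mu := (@leb R d).

Definition box_meetl (a c : pt) : pt := \row_i Num.max (a 0 i) (c 0 i).
Definition box_meetr (b e : pt) : pt := \row_i Num.min (b 0 i) (e 0 i).

Lemma oboxI (a b c e : pt) :
  obox a b `&` obox c e = obox (box_meetl a c) (box_meetr b e).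
Proof.
apply/seteqP; split => [x [/= h1 h2] i|x /= h].
  rewrite !mxE gt_max lt_min.
  by have /andP[-> ->] := h1 i; have /andP[-> ->] := h2 i.
by split => i; have := h i; rewrite !mxE gt_max lt_min;
  move=> /andP[/andP[h1 h2] /andP[h3 h4]]; apply/andP; split.
Qed.

Lemma oboxes_setI_closed : setI_closed (@oboxes R d).
Proof.
move=> _ _ [[a b] _ <-] [[c e] _ <-] /=; rewrite oboxI.
by exists (box_meetl a c, box_meetr b e).
Qed.

(** Dynkin's theorem for the signed measure with density [g]. Boxes are bounded, so the integral
    over the whole space, on which complements depend, is a separate hypothesis. *)
Lemma integral_oboxes_eq0 (g : pt -> \bar R) :
  mu.-integrable setT g -> (\int[mu]_x g x = 0)%E ->
  (forall a b, \int[mu]_(x in obox a b) g x = 0)%E ->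
  forall S, measurable S -> (\int[mu]_(x in S) g x = 0)%E.
Proof.
move=> ig gT gbox S mS.
suff : <<s @oboxes R d >> `<=`
    [set A | measurable A /\ (induced_charge ig A = 0)%E].
  by move=> /(_ S (measurable_sigma_oboxes mS))[].
rewrite -setI_closed_g_dynkin_g_sigma_algebra; last exact: oboxes_setI_closed.
apply: smallest_sub; last first.
  by move=> _ [[a b] _ <-]; split; [exact: measurable_obox|exact: gbox].
split => [|A [mA A0]|F tF hF].
- by split; [exact: measurableT|exact: gT].
- split; first exact: measurableC.
  have e : (induced_charge ig setT =
      induced_charge ig A + induced_charge ig (~` A))%E.
    have := charge_partition (induced_charge ig) measurableT mA
      (measurableC mA) (setUCr A) (setICr A).
    by rewrite !setTI.
  by move: e; rewrite A0 add0e => <-; exact: gT.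
- have mF k : measurable (F k) by have [] := hF k.
  split; first exact: bigcupT_measurable.
  have := @charge_semi_sigma_additive _ _ _ (induced_charge ig) F mF tF
    (bigcupT_measurable _ mF).
  move=> /cvg_lim <- //.
  rewrite (_ : (fun _ => _) = cst 0%E) ?lim_cst//.
  by apply/funext => k /=; rewrite big1// => i _; have [] := hF i.
Qed.

Lemma integrableMbounded (D : set pt) (f g : pt -> R) (C : R) :
  measurable D -> mu.-integrable D (EFin \o f) -> measurable_fun D g ->
  (forall x, D x -> `|g x| <= C) ->
  mu.-integrable D (EFin \o (fun x => f x * g x)).
Proof.
move=> mD fi mg gC.
have iCf : mu.-integrable D (fun x => C%:E * (EFin \o f) x)%E.
  exact: integrableZl.
apply: (le_integrable mD _ _ iCf).
  apply/measurable_EFinP; apply: measurable_funM => //.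
  by apply/measurable_EFinP; exact: measurable_int fi.
move=> x Dx /=; rewrite lee_fin !normrM mulrC ler_wpM2r//.
exact: le_trans (gC x Dx) (ler_norm _).
Qed.

(** Dominated convergence along the bumps of the box, with majorant [|g|]. *)
Lemma integral_obox_eq0 (D : set pt) (g : pt -> R) (a b : pt) :
  measurable D -> mu.-integrable D (EFin \o g) ->
  (forall phi, test_function D phi -> \int[mu]_(x in D) (g x * phi x) = 0) ->
  kbox a b `<=` D -> (\int[mu]_(x in obox a b) (g x)%:E = 0)%E.
Proof.
move=> mD gi gphi abD.
have abD' : obox a b `<=` D.
  by move=> x h; apply: abD => i; have /andP[/ltW -> /ltW ->] := h i.
have mbump k : measurable_fun setT (bump a b k).
  apply: continuous_measurable_rV => x; apply: differentiable_continuous.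
  exact: (@bump_smooth R d a b k nil x).
have mgb k : measurable_fun D (fun x => (g x * bump a b k x)%:E).
  apply/measurable_EFinP; apply: measurable_funM.
    by apply/measurable_EFinP; exact: measurable_int gi.
  exact: measurable_funTS.
have mg1 : measurable_fun D (fun x => (g x * \1_(obox a b) x)%:E).
  apply/measurable_EFinP; apply: measurable_funM.
    by apply/measurable_EFinP; exact: measurable_int gi.
  by apply: measurable_funTS; exact: measurable_indic (measurable_obox a b).
have [_ _ cv] : [/\ mu.-integrable D (fun x => (g x * \1_(obox a b) x)%:E),
    (fun k => \int[mu]_(x in D) `|(g x * bump a b k x)%:E -
      (g x * \1_(obox a b) x)%:E|)%E @ \oo --> 0%E &
    (fun k => \int[mu]_(x in D) (g x * bump a b k x)%:E)%E @ \oo -->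
      (\int[mu]_(x in D) (g x * \1_(obox a b) x)%:E)%E].
  apply: (dominated_convergence mD mgb mg1 _ (integrable_abse gi)).
    apply: aeW => x Dx; apply: cvg_EFin; first by apply: nearW.
    by apply: cvgM; [exact: cvg_cst|exact: cvg_bump].
  apply: aeW => x k Dx /=; rewrite lee_fin normrM ler_piMr//.
  by rewrite ger0_norm ?bump_ge0// bump_le1.
have -> : (\int[mu]_(x in obox a b) (g x)%:E =
    \int[mu]_(x in D) (g x * \1_(obox a b) x)%:E)%E.
  rewrite integral_mkcond [RHS]integral_mkcond.
  apply: eq_integral => x _; rewrite !patchE indicE.
  case: ifPn => xab; last by rewrite mulr0; case: ifP.
  rewrite (_ : x \in D) ?mulr1//.
  by rewrite inE; apply: abD'; rewrite inE in xab.
have := cvg_lim _ cv => <- //.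
rewrite (_ : (fun _ => _) = cst 0%E) ?lim_cst//.
apply/funext => k /=.
have ib : mu.-integrable D (EFin \o (fun x => g x * bump a b k x)).
  apply: (@integrableMbounded _ _ _ 1 mD gi); first exact: measurable_funTS.
  by move=> x _; rewrite ger0_norm ?bump_ge0// bump_le1.
rewrite -[LHS]fineK; last exact: integrable_fin_num ib.
by congr (_%:E); exact: (gphi _ (bump_test_function k abD)).
Qed.

(** [g] is cut off to the box first: a box meets it in a box whose closed hull is still inside [D],
    so the cut-off function integrates to 0 over all boxes, including those that leave [D]. *)
Lemma ae_eq0_obox (D : set pt) (g : pt -> R) (a b : pt) :
  measurable D -> mu.-integrable D (EFin \o g) ->
  (forall phi, test_function D phi -> \int[mu]_(x in D) (g x * phi x) = 0) ->
  kbox a b `<=` D -> {ae mu, forall x, obox a b x -> g x = 0}.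
Proof.
move=> mD gi gphi abD.
have mab : measurable (obox a b) by exact: measurable_obox.
have abD' : obox a b `<=` D.
  by move=> x h; apply: abD => i; have /andP[/ltW -> /ltW ->] := h i.
pose h := (EFin \o g) \_ (obox a b).
have hi : mu.-integrable setT h.
  apply/integrable_restrict => //; rewrite setTI.
  exact: (integrableS mD mab abD').
have h0 S : measurable S -> (\int[mu]_(x in S) h x = 0)%E.
  apply: integral_oboxes_eq0 => //.
    by rewrite /h -integral_mkcond; exact: (integral_obox_eq0 mD).
  move=> c e; rewrite /h -integral_mkcondr oboxI.
  apply: (integral_obox_eq0 mD) => //; apply: subset_trans abD => x hx i.
  have := hx i; rewrite !mxE ge_max le_min => /andP[/andP[_ ->]].
  by move=> /andP[_ ->].
have := @integral_ae_eq _ _ _ mu setT measurableT (cst 0%E) h hi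
  (measurable_cst _).
have hh E : E `<=` setT -> measurable E ->
    (\int[mu]_(x in E) h x = \int[mu]_(x in E) cst 0 x)%E.
  by move=> _ mE; rewrite h0// integral0.
move=> /(_ hh); apply: filterS => x /= /(_ I) + xab.
by rewrite /h patchE mem_set//= => -[].
Qed.

Lemma fundamental_lemma (D : set pt) (g : pt -> R) :
  open D -> mu.-integrable D (EFin \o g) ->
  (forall phi, test_function D phi -> \int[mu]_(x in D) (g x * phi x) = 0) ->
  {ae mu, forall x, D x -> g x = 0}.
Proof.
move=> oD gi gphi.
have mD : measurable D := measurable_open_rV oD.
pose Q (p : 'rV[rat]_d * 'rV[rat]_d) : set pt :=
  obox (map_mx ratr p.1) (map_mx ratr p.2).
(* Rational boxes are numbered by [pickle], so the exceptional set is a sequence of null sets;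
   numbers that code no admissible box give the empty set. *)
pose F k : set pt := if unpickle k is Some p then
  if asbool (kbox (map_mx ratr p.1) (map_mx ratr p.2) `<=` D)
  then [set x | Q p x /\ g x <> 0] else set0 else set0.
suff : mu.-negligible (~` [set x | D x -> g x = 0]) by [].
apply: (@negligibleS _ _ _ mu (\bigcup_k F k)); last first.
  apply: negligible_bigcup => k; rewrite /F.
  case: unpickle => [p|]; last exact: negligible_set0.
  case: asboolP => [pD|_]; last exact: negligible_set0.
  apply: negligibleS (ae_eq0_obox mD gi gphi pD).
  by move=> x [Qx gx] /= /(_ Qx).
move=> x /= /not_implyP[Dx gx].
move: (Dx); rewrite (bigcup_rat_obox oD) => -[p /= pD xp].
by exists (pickle p) => //; rewrite /F pickleK asboolT.
Qed.

End fundamental_lemma.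

(** * Square-integrable functions, test functions and integration by parts *)

Section square_integrable.
Context (R : realType) (d : nat).
Local Notation pt := 'rV[R]_d.
Local Notation mu := (@leb R d).
Implicit Types (D : set pt) (u v : pt -> R).

Lemma L2_integrable_sqr D u : L2 D u ->
  mu.-integrable D (EFin \o (fun x => u x ^+ 2)).
Proof.
move=> [mu_u ui]; apply/integrableP; split.
  by apply/measurable_EFinP; exact: measurable_funX.
rewrite (eq_integral (fun x => (u x ^+ 2)%:E))// => x _ /=.
by rewrite ger0_norm// sqr_ge0.
Qed.

Lemma integrable_sqr_L2 D u : measurable_fun D u ->
  mu.-integrable D (EFin \o (fun x => u x ^+ 2)) -> L2 D u.
Proof.
move=> mu_u /integrableP[_ ui]; split => //; move: ui.
rewrite (eq_integral (fun x => (u x ^+ 2)%:E))// => x _ /=.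
by rewrite ger0_norm// sqr_ge0.
Qed.

Lemma norm_mul_le_sqrD (a b : R) : `|a * b| <= a ^+ 2 + b ^+ 2.
Proof.
have := sqr_ge0 (`|a| - `|b|).
rewrite normrM -[a ^+ 2]real_normK ?num_real// -[b ^+ 2]real_normK ?num_real//.
have := normr_ge0 a; have := normr_ge0 b; nra.
Qed.

Lemma L2_integrableM D u v : measurable D -> L2 D u -> L2 D v ->
  mu.-integrable D (EFin \o (fun x => u x * v x)).
Proof.
move=> mD u2 v2; have iu := L2_integrable_sqr u2; have iv := L2_integrable_sqr v2.
apply: (le_integrable mD _ _ (integrableD mD iu iv)).
  by apply/measurable_EFinP; apply: measurable_funM; [case: u2|case: v2].
move=> x Dx /=; rewrite lee_fin.
by apply: (le_trans (norm_mul_le_sqrD _ _)); exact: ler_norm.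
Qed.

Lemma L2_integrable D u : measurable D -> (mu D < +oo)%E -> L2 D u ->
  mu.-integrable D (EFin \o u).
Proof.
move=> mD Doo u2.
have c2 : L2 D (cst 1).
  split; first exact: measurable_cst.
  rewrite (eq_integral (cst 1%:E)); last by move=> x _ /=; rewrite expr1n.
  by rewrite integral_cst// mul1e.
have := L2_integrableM mD u2 c2.
by apply: eq_integrable => // x _ /=; rewrite mulr1.
Qed.

Lemma L2_lin D (c : R) u v : measurable D -> L2 D u -> L2 D v ->
  L2 D (fun x => c * u x + v x).
Proof.
move=> mD u2 v2; have iu := L2_integrable_sqr u2; have iv := L2_integrable_sqr v2.
have mc : measurable_fun D (fun x => c * u x + v x).
  apply: measurable_funD; last by case: v2.
  by apply: measurable_funM; [exact: measurable_cst|case: u2].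
apply: integrable_sqr_L2 => //.
have iuv := L2_integrableM mD u2 v2.
have := integrableD mD (integrableD mD (integrableZl mD (c ^+ 2) iu)
  (integrableZl mD (2 * c) iuv)) iv.
apply: eq_integrable => // x _ /=.
rewrite -!EFinM -!EFinD; congr (_%:E); ring.
Qed.

Lemma L2_subset D D' u : measurable D -> measurable D' -> D' `<=` D ->
  L2 D u -> L2 D' u.
Proof.
move=> mD mD' DD' u2; apply: integrable_sqr_L2.
  by apply: (measurable_funS mD DD'); case: u2.
exact: (integrableS mD mD' DD' (L2_integrable_sqr u2)).
Qed.

Lemma smooth_continuous u : smooth u -> continuous u.
Proof.
by move=> su x; apply: differentiable_continuous; exact: (su [::] x).
Qed.

Lemma smooth_partial u i : smooth u -> smooth (partial i u).
Proof.
by move=> su s x; have := su (rcons s i) x; rewrite foldr_rcons.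
Qed.

Lemma test_function_partial D phi i :
  test_function D phi -> test_function D (partial i phi).
Proof.
move=> [sphi [K [cK KD phi0]]]; split; first exact: smooth_partial.
exists K; split => // x; apply: (partial_eq0 i _ phi0).
by apply: compact_closed.
Qed.

Lemma test_function_support D phi : test_function D phi ->
  exists2 M : R, 0 < M & forall x, ~ cbox M x -> phi x = 0.
Proof.
move=> [_ [K [cK _ phi0]]]; have [M M0 KM] := bounded_sub_cbox (compact_bounded cK).
by exists M => // x nx; apply: phi0 => /KM.
Qed.

Lemma test_function_notin D phi x : test_function D phi -> ~ D x -> phi x = 0.
Proof. by move=> [_ [K [_ KD phi0]]] nD; apply: phi0 => /KD. Qed.

Lemma test_function_subset D D' phi : D `<=` D' ->
  test_function D phi -> test_function D' phi.
Proof.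
move=> DD' [sphi [K [cK KD phi0]]]; split => //.
by exists K; split => //; exact: subset_trans DD'.
Qed.

Lemma test_function_measurable D D' phi : test_function D' phi ->
  measurable_fun D phi.
Proof.
move=> [sphi _]; apply: measurable_funTS; apply: continuous_measurable_rV.
exact: smooth_continuous.
Qed.

Lemma test_function_L2 D D' phi : measurable D -> test_function D' phi -> L2 D phi.
Proof.
move=> mD tphi; apply: (@L2_subset setT) => //.
have [M _ phi0] := test_function_support tphi.
have cphi := smooth_continuous tphi.1.
apply: integrable_sqr_L2; first exact: test_function_measurable tphi.
apply: (@integrable_continuous_support _ _ _ M); last first.
  by move=> x /phi0 ->; rewrite expr0n.
by move=> x; exact: (cvgM (cphi x) (cphi x)).
Qed.

Lemma test_function_Rintegral D phi u : measurable D -> test_function D phi ->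
  \int[mu]_(x in D) (u x * phi x) = \int[mu]_x (u x * phi x).
Proof.
move=> mD tphi; rewrite Rintegral_mkcond; apply: eq_Rintegral => x _.
rewrite patchE; case: ifPn => //; rewrite notin_setE.
by move=> /(test_function_notin tphi) ->; rewrite mulr0.
Qed.

(** [psi] vanishes off [D], so both integrals extend to the whole space, where their sum is the
    integral of [partial i (phi * psi)]. [phi] may cross the boundary of [D]. *)
Lemma Rintegral_by_parts D phi psi i : test_function setT phi ->
  test_function D psi -> measurable D ->
  \int[mu]_(x in D) (phi x * partial i psi x) =
  - \int[mu]_(x in D) (partial i phi x * psi x).
Proof.
move=> tphi tpsi mD.
have tpsi' := test_function_partial i tpsi.
have tphi' := test_function_partial i tphi.
rewrite (test_function_Rintegral _ mD tpsi) (test_function_Rintegral _ mD tpsi').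
apply/eqP; rewrite -addr_eq0 -RintegralD//; last 2 first.
- exact: (L2_integrableM measurableT (test_function_L2 measurableT tphi)
    (test_function_L2 measurableT tpsi')).
- exact: (L2_integrableM measurableT (test_function_L2 measurableT tphi')
    (test_function_L2 measurableT tpsi)).
have eP x : partial i (phi * psi) x = phi x * partial i psi x + partial i phi x * psi x.
  rewrite /partial deriveM; first by rewrite /GRing.scale/= [psi x * _]mulrC.
  - by apply: diff_derivable; exact: (tphi.1 [::] x).
  - by apply: diff_derivable; exact: (tpsi.1 [::] x).
have [M _ psi0] := test_function_support tpsi.
have := @integral_partial_eq0 R d (phi * psi) i M.
rewrite /Rintegral => h; rewrite -[X in _ == X](_ : fine 0%E = _)//.
apply/eqP; congr fine; rewrite -[RHS]h.
- by apply: eq_integral => x _; rewrite eP.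
- move=> x; apply: diff_derivable; apply: differentiableM.
    exact: (tphi.1 [::] x).
  exact: (tpsi.1 [::] x).
- rewrite (_ : partial i (phi * psi) =
      fun x => phi x * partial i psi x + partial i phi x * psi x); last exact/funext.
  have c1 := smooth_continuous tphi.1; have c2 := smooth_continuous tphi'.1.
  have c3 := smooth_continuous tpsi.1; have c4 := smooth_continuous tpsi'.1.
  move=> x; exact: (cvgD (cvgM (c1 x) (c4 x)) (cvgM (c2 x) (c3 x))).
- by move=> x /psi0 e; rewrite -[LHS]/(phi x * psi x) e mulr0.
Qed.

End square_integrable.

(** * Linearity, locality and uniqueness of weak gradients *)

Section weak_gradients.
Context (R : realType) (d : nat).
Local Notation pt := 'rV[R]_d.
Local Notation mu := (@leb R d).
Implicit Types (D : set pt) (u v : pt -> R) (g h : pt -> pt).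

Lemma weak_grad_test D phi : measurable D -> test_function setT phi ->
  is_weak_grad D phi (fun x => \row_i partial i phi x).
Proof.
move=> mD tphi; split => [i|psi tpsi i].
  under eq_fun do rewrite mxE.
  exact: (test_function_L2 mD (test_function_partial i tphi)).
under [in RHS]eq_Rintegral do rewrite mxE.
exact: Rintegral_by_parts.
Qed.

Lemma weak_grad_lin D (c : R) u v g h : measurable D -> L2 D u -> L2 D v ->
  is_weak_grad D u g -> is_weak_grad D v h ->
  is_weak_grad D (fun x => c * u x + v x) (fun x => c *: g x + h x).
Proof.
move=> mD u2 v2 [g2 ug] [h2 vh]; split => [i|phi tphi i].
  under eq_fun do rewrite !mxE.
  exact: L2_lin.
have t2 := test_function_L2 mD tphi.
have t2' := test_function_L2 mD (test_function_partial i tphi).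
under eq_Rintegral do rewrite mulrDl -mulrA.
under [in RHS]eq_Rintegral do rewrite !mxE mulrDl -mulrA.
have i1 := L2_integrableM mD u2 t2'; have i2 := L2_integrableM mD v2 t2'.
have i3 := L2_integrableM mD (g2 i) t2; have i4 := L2_integrableM mD (h2 i) t2.
rewrite !RintegralD//.
- rewrite !RintegralZl//.
  by rewrite ug// vh// mulrN opprD.
- exact: (integrableZl mD c i3).
- exact: (integrableZl mD c i1).
Qed.

Lemma ae_eq_Rintegral D u v : measurable D -> measurable_fun D u ->
  measurable_fun D v -> {ae mu, forall x, D x -> u x = v x} ->
  \int[mu]_(x in D) u x = \int[mu]_(x in D) v x.
Proof.
move=> mD mu_u mu_v uv; rewrite /Rintegral; congr fine.
apply: ae_eq_integral => //; [exact/measurable_EFinP|exact/measurable_EFinP|].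
by apply: filterS uv => x h Dx; rewrite h.
Qed.

Lemma weak_grad_ae D u v g : measurable D -> measurable_fun D u ->
  measurable_fun D v -> {ae mu, forall x, D x -> u x = v x} ->
  is_weak_grad D u g -> is_weak_grad D v g.
Proof.
move=> mD mu_u mu_v uv [g2 ug]; split => // phi tphi i.
rewrite -ug//; apply: ae_eq_Rintegral => //.
- apply: measurable_funM => //.
  exact: (test_function_measurable (test_function_partial i tphi)).
- apply: measurable_funM => //.
  exact: (test_function_measurable (test_function_partial i tphi)).
- by apply: filterS uv => x h Dx; rewrite h.
Qed.

Lemma weak_grad_unique D u g h : open D -> (mu D < +oo)%E ->
  is_weak_grad D u g -> is_weak_grad D u h ->
  {ae mu, forall x, D x -> g x = h x}.
Proof.
move=> oD Doo [g2 ug] [h2 uh].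
have mD := measurable_open_rV oD.
have : {ae mu, forall x, forall i : 'I_d, D x -> -1 * g x 0 i + h x 0 i = 0}.
  apply: filter_forall => i; apply: fundamental_lemma => //.
    (* Finite measure enters here: the fundamental lemma wants an integrable function, and the
       gradients are only square-integrable. *)
    apply: (L2_integrable mD Doo); exact: L2_lin.
  move=> phi tphi.
  have t2 := test_function_L2 mD tphi.
  have i3 := L2_integrableM mD (g2 i) t2; have i4 := L2_integrableM mD (h2 i) t2.
  under eq_Rintegral do rewrite mulrDl -mulrA.
  rewrite RintegralD//; last exact: (integrableZl mD (-1) i3).
  rewrite RintegralZl// mulN1r addrC; apply/eqP; rewrite subr_eq0; apply/eqP.
  by apply: oppr_inj; rewrite -ug// -uh.
apply: filterS => x hx Dx; apply/rowP => i.
by have := hx i Dx; rewrite mulN1r addrC => /eqP; rewrite subr_eq0 => /eqP.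
Qed.

(** A test function of [D'] is one of [D], and the integrals over either set equal those over the
    whole space. *)
Lemma weak_grad_subset D D' u g : measurable D -> measurable D' -> D' `<=` D ->
  is_weak_grad D u g -> is_weak_grad D' u g.
Proof.
move=> mD mD' sD [g2 ug]; split => [i|phi tphi i].
  exact: (L2_subset mD mD' sD).
have tphiD := test_function_subset sD tphi.
have := ug phi tphiD i.
rewrite (test_function_Rintegral _ mD tphiD).
rewrite (test_function_Rintegral _ mD (test_function_partial i tphiD)).
rewrite (test_function_Rintegral _ mD' tphi).
by rewrite (test_function_Rintegral _ mD' (test_function_partial i tphi)).
Qed.

Lemma wgradP D u : H1 D u -> is_weak_grad D u (wgrad D u).
Proof. by move=> [_ [g ug]]; rewrite /wgrad; exact: (xgetPex _ (ex_intro _ g ug)). Qed.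

Lemma H1_lin D (c : R) u v : measurable D -> H1 D u -> H1 D v ->
  H1 D (fun x => c * u x + v x).
Proof.
move=> mD [u2 [g ug]] [v2 [h vh]]; split; first exact: L2_lin.
by exists (fun x => c *: g x + h x); exact: weak_grad_lin.
Qed.

Lemma H1_subset D D' u : measurable D -> measurable D' -> D' `<=` D ->
  H1 D u -> H1 D' u.
Proof.
move=> mD mD' sD [u2 [g ug]]; split; first exact: (L2_subset mD mD' sD).
by exists g; exact: (weak_grad_subset mD mD' sD).
Qed.

Lemma H1_test D phi : measurable D -> test_function setT phi -> H1 D phi.
Proof.
move=> mD tphi; split; first exact: (test_function_L2 mD tphi).
by exists (fun x => \row_i partial i phi x); exact: weak_grad_test.
Qed.

End weak_gradients.

(** * Linear structure of H^1_0 and a Poincare inequality *)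

Section poincare.
Context (R : realType) (d : nat).
Local Notation pt := 'rV[R]_d.
Local Notation mu := (@leb R d).
Implicit Types (D : set pt) (u v w phi : pt -> R) (g h : pt -> pt).

Definition sqnorm D u : R := \int[mu]_(x in D) (u x ^+ 2).

(** The square of [H1norm], with an arbitrary gradient [g] in place of the chosen [wgrad]. *)
Definition energy D u g : R :=
  sqnorm D u + \sum_(i < d) sqnorm D (fun x => g x 0 i).

Lemma sqnorm_ge0 D u : 0 <= sqnorm D u.
Proof. by apply: Rintegral_ge0 => x _; exact: sqr_ge0. Qed.

Lemma energy_ge0 D u g : 0 <= energy D u g.
Proof. by rewrite addr_ge0 ?sqnorm_ge0// sumr_ge0// => i _; exact: sqnorm_ge0. Qed.

Lemma sqnorm_le_energy D u g : sqnorm D u <= energy D u g.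
Proof. by rewrite lerDl sumr_ge0// => i _; exact: sqnorm_ge0. Qed.

Lemma sqnorm_grad_le_energy D u g i :
  sqnorm D (fun x => g x 0 i) <= energy D u g.
Proof.
rewrite /energy (bigD1 i)//= addrCA lerDl addr_ge0 ?sqnorm_ge0//.
by rewrite sumr_ge0// => j _; exact: sqnorm_ge0.
Qed.

(** Stands in for the triangle inequality: at the price of a factor 2 it integrates directly,
    without Minkowski. *)
Lemma sqr_lin_le (c a b : R) : (c * a + b) ^+ 2 <= 2 * c ^+ 2 * a ^+ 2 + 2 * b ^+ 2.
Proof. have := sqr_ge0 (c * a - b); nra. Qed.

Lemma sqnorm_lin_le D (c : R) u v : measurable D -> L2 D u -> L2 D v ->
  sqnorm D (fun x => c * u x + v x) <= 2 * c ^+ 2 * sqnorm D u + 2 * sqnorm D v.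
Proof.
move=> mD u2 v2.
have iu := L2_integrable_sqr u2; have iv := L2_integrable_sqr v2.
have i1 : mu.-integrable D (EFin \o (fun x => 2 * c ^+ 2 * u x ^+ 2)).
  exact: (integrableZl mD (2 * c ^+ 2) iu).
have i2 : mu.-integrable D (EFin \o (fun x => 2 * v x ^+ 2)).
  exact: (integrableZl mD 2 iv).
rewrite /sqnorm -(RintegralZl _ mD iu) -(RintegralZl _ mD iv) -RintegralD//.
apply: le_Rintegral => //.
- exact: (L2_integrable_sqr (L2_lin c mD u2 v2)).
- exact: (integrableD mD i1 i2).
- by move=> x _; exact: sqr_lin_le.
Qed.

Lemma energy_lin_le D (c : R) u v g h : measurable D -> L2 D u -> L2 D v ->
  (forall i, L2 D (fun x => g x 0 i)) -> (forall i, L2 D (fun x => h x 0 i)) ->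
  energy D (fun x => c * u x + v x) (fun x => c *: g x + h x) <=
  2 * c ^+ 2 * energy D u g + 2 * energy D v h.
Proof.
move=> mD u2 v2 g2 h2.
rewrite /energy !mulrDr addrACA lerD//; first exact: sqnorm_lin_le.
rewrite !mulr_sumr -big_split/=; apply: ler_sum => i _.
under eq_fun do rewrite !mxE.
exact: (sqnorm_lin_le c mD (g2 i) (h2 i)).
Qed.

Lemma ae_eq_sqnorm D u v : measurable D -> measurable_fun D u ->
  measurable_fun D v -> {ae mu, forall x, D x -> u x = v x} ->
  sqnorm D u = sqnorm D v.
Proof.
move=> mD mu_u mu_v uv; apply: ae_eq_Rintegral => //.
- exact: measurable_funX.
- exact: measurable_funX.
- by apply: filterS uv => x h Dx; rewrite h.
Qed.

Lemma energy_unique D u g h : open D -> (mu D < +oo)%E ->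
  is_weak_grad D u g -> is_weak_grad D u h -> energy D u g = energy D u h.
Proof.
move=> oD Doo ug uh; congr (_ + _); apply: eq_bigr => i _.
apply: ae_eq_sqnorm.
- exact: measurable_open_rV.
- by case: ug => /(_ i)[].
- by case: uh => /(_ i)[].
- by apply: filterS (weak_grad_unique oD Doo ug uh) => x e Dx; rewrite e.
Qed.

Lemma H1norm_energy D u g : open D -> (mu D < +oo)%E -> L2 D u ->
  is_weak_grad D u g -> H1norm D u = Num.sqrt (energy D u g).
Proof.
move=> oD Doo u2 ug.
have uw : is_weak_grad D u (wgrad D u).
  by apply: wgradP; split => //; exists g.
by rewrite (energy_unique oD Doo ug uw).
Qed.

Lemma energy_lt D u g (e : R) : open D -> (mu D < +oo)%E -> L2 D u ->
  is_weak_grad D u g -> H1norm D u < e -> energy D u g < e ^+ 2.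
Proof.
move=> oD Doo u2 ug; rewrite (H1norm_energy oD Doo u2 ug) => ltE.
rewrite -[ltLHS]sqr_sqrtr ?energy_ge0// ltrXn2r ?nnegrE ?sqrtr_ge0//.
Qed.

Lemma H1norm_lt D u g (e : R) : open D -> (mu D < +oo)%E -> L2 D u ->
  is_weak_grad D u g -> 0 < e -> energy D u g < e ^+ 2 -> H1norm D u < e.
Proof.
move=> oD Doo u2 ug e0 ltE; rewrite (H1norm_energy oD Doo u2 ug).
by rewrite -(gtr0_norm e0) -sqrtr_sqr ltr_sqrt ?exprn_gt0.
Qed.

Lemma smooth_lin (c : R) u v : smooth u -> smooth v ->
  smooth (fun x => c * u x + v x).
Proof.
move=> su sv s.
have e : foldr (@partial R d) (fun x => c * u x + v x) s =
    (fun x => c * foldr (@partial R d) u s x + foldr (@partial R d) v s x).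
  elim: s => //= i s ->; apply/funext => x; rewrite /partial.
  set U := foldr _ u s; set V := foldr _ v s.
  have dU : derivable U x (delta_mx 0 i) by exact/diff_derivable/(su s).
  have dV : derivable V x (delta_mx 0 i) by exact/diff_derivable/(sv s).
  transitivity ('D_(delta_mx 0 i) (c *: U + V) x); first by [].
  by rewrite (deriveD (derivableZ dU) dV) (deriveZ c dU).
move=> x; rewrite e; apply: differentiableD; last exact: sv.
by apply: (@differentiableZ _ _ _ (foldr _ u s)); exact: su.
Qed.

Lemma test_function_lin D (c : R) u v : test_function D u -> test_function D v ->
  test_function D (fun x => c * u x + v x).
Proof.
move=> [su [K [cK KD u0]]] [sv [L [cL LD v0]]]; split; first exact: smooth_lin.
exists (K `|` L); split.
- exact: compactU.
- by move=> x [/KD|/LD].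
- by move=> x nx; rewrite u0 ?v0 ?mulr0 ?addr0// => h; apply: nx; [right|left].
Qed.

Lemma sqr_lin_lt_scaled (k b E1 E2 : R) : 0 <= k -> 0 < b -> E1 < b ^+ 2 ->
  E2 < b ^+ 2 -> 0 <= E2 -> 0 <= E1 ->
  2 * k ^+ 2 * E1 + 2 * E2 < (2 * (k + 1) * b) ^+ 2.
Proof.
move=> k0 b0 h1 h2 E20 E10.
have hk : k ^+ 2 * E1 <= k ^+ 2 * b ^+ 2 by rewrite ler_wpM2l ?sqr_ge0// ltW.
have p1 : 0 < b ^+ 2 by rewrite exprn_gt0.
have p2 : 0 <= k * b ^+ 2 by rewrite mulr_ge0// sqr_ge0.
have p3 : 0 <= k ^+ 2 * b ^+ 2 by rewrite mulr_ge0// sqr_ge0.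
have -> : (2 * (k + 1) * b) ^+ 2 =
    4 * (k ^+ 2 * b ^+ 2) + 8 * (k * b ^+ 2) + 4 * b ^+ 2 by ring.
rewrite -mulrA; lra.
Qed.

Lemma H10_lin D (c : R) u v : open D -> (mu D < +oo)%E -> H10 D u -> H10 D v ->
  H10 D (fun x => c * u x + v x).
Proof.
move=> oD Doo [u1 ua] [v1 va]; have mD := measurable_open_rV oD.
split; first exact: H1_lin.
(* Chosen so that the bound [2 * (k + 1) * b] of [sqr_lin_lt_scaled], at [k = |c|], is exactly
   [e]. *)
move=> e e0; pose b := e / (2 * (`|c| + 1)).
have c1 : 0 < `|c| + 1 by rewrite ltr_wpDl.
have b0 : 0 < b by rewrite divr_gt0// mulr_gt0.
have [phi tphi hphi] := ua b b0; have [psi tpsi hpsi] := va b b0.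
exists (fun x => c * phi x + psi x); first exact: test_function_lin.
have sub f t : H1 D f -> test_function D t -> L2 D (fun x => f x - t x) /\
    exists g, is_weak_grad D (fun x => f x - t x) g.
  move=> f1 tt.
  have t1 : H1 D t.
    by apply: H1_test => //; exact: test_function_subset tt.
  have := H1_lin (-1) mD t1 f1.
  rewrite (_ : (fun x => -1 * t x + f x) = (fun x => f x - t x)) => [[]//|].
  by apply/funext => x; rewrite mulN1r addrC.
have [f2 [g fg]] := sub _ _ u1 tphi; have [k2 [h kh]] := sub _ _ v1 tpsi.
have hu := energy_lt oD Doo f2 fg hphi.
have hv := energy_lt oD Doo k2 kh hpsi.
rewrite (_ : (fun x => c * u x + v x - (c * phi x + psi x)) =
    (fun x => c * (u x - phi x) + (v x - psi x))); last first.
  by apply/funext => x; ring.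
apply: (H1norm_lt oD Doo (L2_lin c mD f2 k2)
  (weak_grad_lin c mD f2 k2 fg kh) e0).
apply: le_lt_trans (energy_lin_le c mD f2 k2 fg.1 kh.1) _.
have eb : e = 2 * (`|c| + 1) * b by rewrite mulrC /b divfK// gt_eqF// mulr_gt0.
have c2 : c ^+ 2 = `|c| ^+ 2 by rewrite real_normK ?num_real.
have := energy_ge0 D (fun x => u x - phi x) g.
have := energy_ge0 D (fun x => v x - psi x) h.
move: (energy _ _ _) (energy _ _ _) hu hv => E1 E2.
rewrite eb c2 => h1 h2 E20 E10.
exact: (sqr_lin_lt_scaled (normr_ge0 c) b0).
Qed.

(** Half the square of [a + 2 * (t * b)], which is nonnegative, together with [t ^+ 2 <= M ^+ 2]. *)
Lemma poincare_pointwise (M a b t : R) : `|t| <= M ->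
  1 / 2 * a ^+ 2 - 2 * M ^+ 2 * b ^+ 2 <= a ^+ 2 + 2 * (t * (a * b)).
Proof.
move=> tM; have := sqr_ge0 (a + 2 * (t * b)).
have : t ^+ 2 * b ^+ 2 <= M ^+ 2 * b ^+ 2.
  rewrite ler_wpM2r ?sqr_ge0// -(real_normK (num_real t)).
  by rewrite lerXn2r ?nnegrE// (le_trans _ tM).
nra.
Qed.

(* Integrate [d_i (x_i phi^2) = phi^2 + 2 x_i phi d_i phi], whose integral
   vanishes, and absorb half of [phi^2] by Young's inequality. *)
Lemma poincare_test D phi (i : 'I_d) (M : R) : measurable D -> D `<=` cbox M ->
  test_function D phi ->
  sqnorm D phi <= 4 * M ^+ 2 * sqnorm D (partial i phi).
Proof.
move=> mD DM tphi; have tphi' := test_function_partial i tphi.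
have phi0 x : ~ cbox M x -> phi x = 0.
  by move=> nx; apply: (test_function_notin tphi) => /DM.
have dphi0 x : ~ cbox M x -> partial i phi x = 0.
  by move=> nx; apply: (test_function_notin tphi') => /DM.
pose X : pt -> R := fun x => x 0 i.
have dF x : differentiable (X * (phi * phi)) x.
  apply: differentiableM; first exact: differentiable_coord.
  by apply: differentiableM; exact: (tphi.1 [::] x).
have eF : partial i (X * (phi * phi)) =
    fun x => phi x ^+ 2 + 2 * (x 0 i * (phi x * partial i phi x)).
  apply/funext => x; rewrite /partial deriveM; last 2 first.
  - by apply: diff_derivable; exact: differentiable_coord.
  - by apply: diff_derivable; apply: differentiableM; exact: (tphi.1 [::] x).
  rewrite deriveM; last 2 first.
  - by apply: diff_derivable; exact: (tphi.1 [::] x).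
  - by apply: diff_derivable; exact: (tphi.1 [::] x).
  have [_ ->] := is_derive_coord x (delta_mx 0 i) i.
  rewrite mxE !eqxx /GRing.scale/= /X -[(phi * phi) x]/(phi x * phi x); ring.
have cphi := smooth_continuous tphi.1; have cphi' := smooth_continuous tphi'.1.
have cX : continuous X by exact: coord_continuous.
have cF : continuous (partial i (X * (phi * phi))).
  have c2 : continuous (fun x => phi x ^+ 2).
    by move=> x; exact: (cvgM (cphi x) (cphi x)).
  have c3 : continuous (fun x => 2 * (X x * (phi x * partial i phi x))).
    move=> x; apply: (cvgM (@cst_continuous _ _ (2 : R) x)).
    exact: (cvgM (cX x) (cvgM (cphi x) (cphi' x))).
  by rewrite eF => x; exact: (cvgD (c2 x) (c3 x)).
have F0 x : ~ cbox M x -> (X * (phi * phi)) x = 0.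
  by move=> /phi0 e; rewrite -[LHS]/(X x * (phi x * phi x)) e !mulr0.
have i0 := integral_partial_eq0 (fun x => diff_derivable (dF x)) cF F0.
have iF := integrable_continuous_support cF (partial_eq0 i (@closed_cbox _ _ _) F0).
have p2 := L2_integrable_sqr (test_function_L2 measurableT tphi).
have q2 := L2_integrable_sqr (test_function_L2 measurableT tphi').
(* The vanishing integral of the derivative is known over the whole space only. *)
have toT f : test_function D f -> sqnorm D f = sqnorm setT f.
  move=> tf; rewrite /sqnorm Rintegral_mkcond; apply: eq_Rintegral => x _.
  rewrite patchE; case: ifPn => //; rewrite notin_setE.
  by move=> /(test_function_notin tf) ->; rewrite expr0n.
rewrite !toT//.
have j1 : mu.-integrable setT (EFin \o (fun x => 1 / 2 * phi x ^+ 2)).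
  exact: (integrableZl measurableT (1 / 2) p2).
have j2 : mu.-integrable setT
    (EFin \o (fun x => 2 * M ^+ 2 * partial i phi x ^+ 2)).
  exact: (integrableZl measurableT (2 * M ^+ 2) q2).
have j3 := integrableB measurableT j1 j2.
have : \int[mu]_x (1 / 2 * phi x ^+ 2 - 2 * M ^+ 2 * partial i phi x ^+ 2) <=
    \int[mu]_x partial i (X * (phi * phi)) x.
  apply: le_Rintegral => // x _; rewrite eF.
  have [xM|nx] := pselect (cbox M x); first exact: (poincare_pointwise _ _ (xM i)).
  by rewrite phi0// dphi0// expr0n/= !mul0r !mulr0 addr0 subr0.
(* What remains is [1 / 2] times the norm of [phi] at most [2 * M ^+ 2] times that of its
   derivative, whence the constant [4 * M ^+ 2]. *)
rewrite [leRHS]/Rintegral i0/= RintegralB// RintegralZl// RintegralZl//.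
rewrite -!/(sqnorm _ _); lra.
Qed.

Lemma sqnorm_eq0 D u : measurable D -> L2 D u -> sqnorm D u = 0 ->
  {ae mu, forall x, D x -> u x = 0}.
Proof.
move=> mD u2 u0; have iu := L2_integrable_sqr u2.
have h : (\int[mu]_(x in D) `|(u x ^+ 2)%:E| = 0)%E.
  rewrite (eq_integral (fun x => (u x ^+ 2)%:E)); last first.
    by move=> x _ /=; rewrite ger0_norm// sqr_ge0.
  by rewrite -[LHS]fineK ?(integrable_fin_num mD iu)//; congr EFin.
have mu2 := measurable_int _ iu.
move/(ae_eq_integral_abs mu mD mu2) : h.
apply: filterS => x /= h Dx; have := h Dx => -[] /eqP.
by rewrite sqrf_eq0 => /eqP.
Qed.

(** [W], [P], [F] and [G] are the squared norms of [w], [phi], [w - phi] and [partial i phi]; thus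
    [W <= 2 * P + 2 * F] and [P <= 4 * M ^+ 2 * G]. *)
Lemma poincare_arith (M q F G P W : R) : F < q -> G < q ->
  P <= 4 * M ^+ 2 * G -> W <= 2 * 1 ^+ 2 * P + 2 * F ->
  W <= (2 + 8 * M ^+ 2) * q.
Proof.
move=> hF hG hP; rewrite expr1n => hW.
have := ler_wpM2l (sqr_ge0 M) (ltW hG); move: (M ^+ 2) hP => m hP hm; nra.
Qed.

(** The Poincare inequality is available for test functions only. If [phi] is close to [w] in H^1,
    then [partial i phi] is small because the gradient of [w] is 0; hence [phi] is small, and so is
    [w]. A single direction [i] suffices. *)
Lemma H10_weak_grad_eq0 D w g (i : 'I_d) : open D -> bounded_set D -> H10 D w ->
  is_weak_grad D w g -> {ae mu, forall x, D x -> g x = 0} ->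
  {ae mu, forall x, D x -> w x = 0}.
Proof.
move=> oD bD [w1 wa] wg g0; have mD := measurable_open_rV oD.
have Doo := bounded_measure_lty mD bD.
have [M M0 DM] := bounded_sub_cbox bD.
apply: sqnorm_eq0 => //; first by case: w1.
apply/eqP; rewrite eq_le sqnorm_ge0 andbT; apply/ler_addgt0Pl => e e0.
rewrite addr0.
pose k : R := 2 + 8 * M ^+ 2.
have k0 : 0 < k by have := sqr_ge0 M; rewrite /k; lra.
(* At this distance the energy of [w - phi] is below [e / k], and [poincare_arith] multiplies it by
   [k]. *)
have s0 : 0 < Num.sqrt (e / k) by rewrite sqrtr_gt0 divr_gt0.
have [phi tphi hphi] := wa _ s0.
have tphiT : test_function setT phi by exact: test_function_subset tphi.
have p2 := test_function_L2 mD tphi.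
have f2 := L2_lin (-1) mD p2 w1.1.
have fg := weak_grad_lin (-1) mD p2 w1.1 (weak_grad_test mD tphiT) wg.
move: hphi; rewrite (_ : (fun x => w x - phi x) = (fun x => -1 * phi x + w x)).
  move=> hphi; have := energy_lt oD Doo f2 fg hphi.
  rewrite sqr_sqrtr ?divr_ge0 ?(ltW e0) ?(ltW k0)// => he.
  have h1 := le_lt_trans (sqnorm_le_energy _ _ _) he.
  have h2 := le_lt_trans (sqnorm_grad_le_energy _ _ _ i) he.
  have h3 : sqnorm D (partial i phi) < e / k.
    rewrite (le_lt_trans _ h2)// le_eqVlt; apply/orP; left; apply/eqP.
    have -> : sqnorm D (partial i phi) = sqnorm D (fun x => -1 * partial i phi x).
      by apply: eq_Rintegral => x _; rewrite mulN1r sqrrN.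
    apply: ae_eq_sqnorm => //.
    + apply: measurable_funM; first exact: measurable_cst.
      exact: (test_function_measurable (test_function_partial i tphi)).
    + by case: (fg.1 i).
    + by apply: filterS g0 => x g0 Dx; rewrite !mxE g0// mxE addr0.
  have h4 := poincare_test i mD DM tphi.
  have h5 := sqnorm_lin_le 1 mD p2 f2.
  have e5 : sqnorm D (fun x => 1 * phi x + (-1 * phi x + w x)) = sqnorm D w.
    by apply: eq_Rintegral => x _; congr (_ ^+ 2); ring.
  rewrite e5 in h5.
  have e6 : e = k * (e / k) by rewrite mulrC divfK// gt_eqF.
  by rewrite e6; exact: (poincare_arith h1 h3 h4 h5).
by apply/funext => x; rewrite mulN1r addrC.
Qed.

End poincare.

(** * Hyperplanes are null sets *)

Section hyperplanes.
Context (R : realType).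
Local Notation mu1 := (@lebesgue_measure R).

Lemma continuous_sum (T : topologicalType) (I : finType) (f : I -> T -> R) :
  (forall i, continuous (f i)) -> continuous (fun x => \sum_i f i x).
Proof.
move=> cf x; apply: cvg_big => [|i _]; last exact: cf.
by move=> z; exact: add_continuous.
Qed.

Lemma continuous_prod (T : topologicalType) (I : finType) (f : I -> T -> R) :
  (forall i, continuous (f i)) -> continuous (fun x => \prod_i f i x).
Proof.
move=> cf x; apply: cvg_big => [|i _]; last exact: cf.
by move=> z; exact: mul_continuous.
Qed.

Definition hyperplane n (nu : 'rV[R]_n) (c : R) : set 'rV[R]_n :=
  [set x | \sum_j nu 0 j * x 0 j = c].

Lemma continuous_dot n (nu : 'rV[R]_n) :
  continuous (fun x : 'rV[R]_n => \sum_j nu 0 j * x 0 j).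
Proof.
apply: continuous_sum => j x.
exact: (cvgM (@cst_continuous _ _ (nu 0 j) x) (@coord_continuous R 1 n 0 j x)).
Qed.

Lemma measurable_hyperplane n (nu : 'rV[R]_n) (c : R) : measurable (hyperplane nu c).
Proof.
rewrite (_ : hyperplane nu c =
    (fun x : 'rV[R]_n => \sum_j nu 0 j * x 0 j) @^-1` [set c])//.
have := continuous_measurable_rV (@continuous_dot n nu) measurableT.
by move=> /(_ [set c] (measurable_set1 c)); rewrite setTI.
Qed.

(** Induction on the dimension: if the last coefficient of the normal is 0, the set is a
    lower-dimensional hyperplane times a line; otherwise each line in the last direction meets it in
    one point. *)
Lemma hyperplane_null n (nu : 'rV[R]_n) (c : R) : nu != 0 ->
  @leb R n (hyperplane nu c) = 0%E.
Proof.
elim: n nu => [|n IH] nu nu0.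
  by case/eqP: nu0; apply/rowP => -[].
have sumE x t : \sum_j nu 0 j * (rV_rcons (x, t) : 'rV[R]_n.+1) 0 j =
    \sum_j nu 0 (lift ord_max j) * x 0 j + nu 0 ord_max * t.
  rewrite big_ord_recr/= rV_rcons_max; congr (_ + _); apply: eq_bigr => j _.
  have -> : widen_ord (leqnSn n) j = lift ord_max j.
    by apply: val_inj; exact/esym/lift_max.
  by rewrite rV_rcons_lift.
have [num0|num0] := eqVneq (nu 0 ord_max) 0.
  pose nu' : 'rV[R]_n := \row_j nu 0 (lift ord_max j).
  rewrite lebS_prod (_ : _ @^-1` _ = hyperplane nu' c `*` setT); last first.
    apply/seteqP; split => -[x t]; rewrite /hyperplane /= sumE num0 mul0r addr0.
      by move=> <-; split => //; apply: eq_bigr => j _; rewrite mxE.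
    by move=> [<- _]; apply: eq_bigr => j _; rewrite mxE.
  rewrite product_measure1E//; last exact: measurable_hyperplane.
  (* The line has infinite measure, and the convention [0 * +oo = 0] applies. *)
  rewrite [X in (X * _)%E](_ : _ = 0%E) ?mul0e//; apply: IH.
  apply: contraNneq nu0 => h; apply/eqP/rowP => j; rewrite mxE.
  case: (unliftP ord_max j) => [k|] -> //.
  by have := congr1 (fun v : 'rV[R]_n => v 0 k) h; rewrite !mxE.
rewrite lebS_prod /product_measure1; apply: integral0_eq => x _ /=.
rewrite (_ : xsection _ x =
    [set (c - \sum_j nu 0 (lift ord_max j) * x 0 j) / nu 0 ord_max]).
  exact: lebesgue_measure_set1.
apply/seteqP; split => t; rewrite /xsection /= inE /hyperplane /= sumE.
  by move=> <-; rewrite addrAC subrr add0r mulrC mulKf.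
by move=> ->; rewrite mulrC divfK// addrC subrK.
Qed.

End hyperplanes.

(** * Boundaries of mesh elements are null sets *)

Section elements.
Context (R : realType) (d : nat).
Local Notation pt := 'rV[R]_d.
Local Notation mu := (@leb R d).

(** The sum is the expansion of a product whose factors [t 0 i + (1 - t 0 i)] are all 1. *)
Lemma sum_cube_weight (t : pt) : \sum_(S : {set 'I_d}) cube_weight t S = 1.
Proof.
transitivity (\prod_(i < d) (t 0 i + (1 - t 0 i))).
  by rewrite bigA_distr; apply: eq_bigr.
by rewrite big1// => i _; rewrite addrC subrK.
Qed.

Lemma conv_comb_coord (I : finType) (p : I -> pt) (l : I -> R) j :
  conv_comb p l 0 j = \sum_i l i * p i 0 j.
Proof. by rewrite /conv_comb summxE; apply: eq_bigr => i _; rewrite mxE. Qed.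

Lemma continuous_box_map (p : {set 'I_d} -> pt) : continuous (box_map p).
Proof.
apply: continuous_rV => j.
rewrite (_ : (fun t => _) = (fun t => \sum_S cube_weight t S * p S 0 j)); last first.
  by apply/funext => t; rewrite /box_map conv_comb_coord.
apply: continuous_sum => S t.
have cw : continuous (fun x : pt => cube_weight x S).
  apply: (@continuous_prod _ _ _ (fun i (t : pt) =>
    if i \in S then t 0 i else 1 - t 0 i)) => i.
  case: (i \in S); first exact: coord_continuous.
  move=> x.
  exact: (cvgB (@cst_continuous _ _ (1 : R) x) (@coord_continuous R 1 d 0 i x)).
exact: (cvgM (cw t) (@cst_continuous _ _ (p S 0 j) t)).
Qed.

Lemma compact_cube : compact (@cube R d).
Proof.
rewrite (_ : @cube R d = kbox 0 (const_mx 1)); first exact: compact_kbox.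
by apply/seteqP; split => t h i; have := h i; rewrite !mxE.
Qed.

Lemma closure_box_subset (p : {set 'I_d} -> pt) :
  closure (body (Box p)) `<=` [set box_map p t | t in @cube R d].
Proof.
have cl : closed [set box_map p t | t in @cube R d].
  apply: compact_closed => //; apply: continuous_compact.
    by apply: continuous_subspaceT; exact: continuous_box_map.
  exact: compact_cube.
apply: (@subset_trans _ (closure [set box_map p t | t in @cube R d])).
  apply: closure_subset => _ [t ht <-]; exists t => // i.
  by have /andP[/ltW -> /ltW ->] := ht i.
exact: cl.
Qed.

(** On the facet only its own vertices have nonzero weight; the functional [nu] equals [c] at each
    of them, and the weights sum to 1. *)
Lemma box_facet_hyperplane (p : {set 'I_d} -> pt) (t nu : pt) (c : R) i (b : bool) :
  t 0 i = b%:R ->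
  (forall S : {set 'I_d}, (i \in S) = b -> (nu *m (p S)^T) 0 0 = c) ->
  hyperplane nu c (box_map p t).
Proof.
move=> ti hnu; rewrite /hyperplane /=.
under eq_bigr do rewrite /box_map conv_comb_coord mulr_sumr.
rewrite exchange_big/=.
rewrite (eq_bigr (fun S => cube_weight t S * c)).
  by rewrite -mulr_suml sum_cube_weight mul1r.
move=> S _; have [hS|hS] := eqVneq (i \in S) b.
  rewrite -(hnu S hS) mxE mulr_sumr; apply: eq_bigr => j _.
  by rewrite mxE mulrCA.
(* For a vertex off the facet the factor of index [i] is [t 0 i = 0] or [1 - t 0 i = 0]. *)
have -> : cube_weight t S = 0.
  rewrite /cube_weight (bigD1 i)//= ti.
  by move: hS; case: (i \in S); case: b {ti hnu} => //= _;
    rewrite ?subrr mul0r.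
by rewrite mul0r big1// => j _; rewrite mul0r mulr0.
Qed.

(** A closure point is the image of a point [t] of the closed cube. Outside the body, some
    coordinate of [t] is 0 or 1, so the point lies in one of the [2 * d] facet hyperplanes. *)
Lemma box_boundary_null (p : {set 'I_d} -> pt) : Defs.nondegenerate (Box p) ->
  mu.-negligible (closure (body (Box p)) `\` body (Box p)).
Proof.
move=> [_ /(_ _ _)/cid-hnu].
pose nu i b := sval (hnu i b); pose c i b := sval (cid (svalP (hnu i b))).
have nuP i b : nu i b != 0 /\ forall S : {set 'I_d}, (i \in S) = b ->
    (nu i b *m (p S)^T) 0 0 = c i b by exact: (svalP (cid (svalP (hnu i b)))).
apply: (@negligibleS _ _ _ mu (\big[setU/set0]_(ib : 'I_d * bool)
    hyperplane (nu ib.1 ib.2) (c ib.1 ib.2))).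
  move=> x [/closure_box_subset[t ct <-] nb].
  have [i ti] : exists i, ~ (0 < t 0 i < 1).
    by apply/existsNP => h; apply: nb; exists t.
  have [b tb] : exists b : bool, t 0 i = b%:R.
    move: (ct i) ti => /andP[t0 t1].
    have [->|tn0] := eqVneq (t 0 i) 0; first by exists false.
    have [->|tn1] := eqVneq (t 0 i) 1; first by exists true.
    by case; rewrite !lt_neqAle t0 t1 eq_sym tn0 tn1.
  rewrite -bigcup_seq; exists (i, b) => /=; first by rewrite mem_index_enum.
  exact: (box_facet_hyperplane tb (nuP i b).2).
apply: big_ind => [|A B|[i b] _]; first exact: negligible_set0.
  exact: negligibleU.
apply/negligibleP; first exact: measurable_hyperplane.
by apply: hyperplane_null; have [] := nuP i b.
Qed.

Section simplex.
Context (p : 'I_d.+1 -> pt).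
Let M : 'M[R]_d := \matrix_(k < d) (p (lift ord0 k) - p ord0).
Context (uM : M \in unitmx).

Let bary_vec (j : 'I_d.+1) : 'cV[R]_d :=
  if unlift ord0 j is Some k then delta_mx k 0 else const_mx (-1).

(** Barycentric coordinates: for [j] other than [ord0], an entry of [(x - p ord0) *m invmx M]; for
    [ord0], 1 minus their sum. The vector [bary_vec j] and the Boolean term merge both cases into
    one affine formula. *)
Let bary (j : 'I_d.+1) (x : pt) : R :=
  ((x - p ord0) *m (invmx M *m bary_vec j)) 0 0 + (j == ord0)%:R.

Let bary_affine j : exists nu : pt, exists c, (forall x,
  bary j x = \sum_k nu 0 k * x 0 k - c) /\ ((0 < d)%N -> nu != 0).
Proof.
exists (invmx M *m bary_vec j)^T.
exists ((p ord0 *m (invmx M *m bary_vec j)) 0 0 - (j == ord0)%:R); split.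
  move=> x; rewrite /bary; move: (invmx M *m _) => B.
  have -> : ((x - p ord0) *m B) 0 0 = (x *m B) 0 0 - (p ord0 *m B) 0 0.
    by rewrite mulmxBl [LHS]mxE; congr (_ + _); rewrite [LHS]mxE.
  rewrite opprB addrA [LHS]addrAC; congr (_ + _ - _).
  by rewrite mxE; apply: eq_bigr => k _; rewrite [_^T _ _]mxE mulrC.
move=> d0; rewrite trmx_eq0; apply/eqP => h.
have : bary_vec j = 0 by rewrite -[LHS]mul1mx -(mulmxV uM) -mulmxA h mulmx0.
rewrite /bary_vec; case: unliftP => [k|] _ /matrixP.
  by move=> /(_ k 0)/eqP; rewrite !mxE !eqxx oner_eq0.
by move=> /(_ (Ordinal d0) 0)/eqP; rewrite !mxE oppr_eq0 oner_eq0.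
Qed.

Let bary_conv_comb (l : 'I_d.+1 -> R) j : \sum_i l i = 1 ->
  bary j (conv_comb p l) = l j.
Proof.
move=> l1.
have xE : conv_comb p l - p ord0 = (\row_k l (lift ord0 k)) *m M.
  apply/rowP => a; rewrite !mxE conv_comb_coord -[p ord0 0 a]mul1r -l1 mulr_suml.
  rewrite -sumrB big_ord_recl subrr add0r; apply: eq_bigr => k _.
  by rewrite !mxE mulrBr.
rewrite /bary xE -mulmxA [M *m _]mulmxA mulmxV// mul1mx /bary_vec.
case: unliftP => [k|] ->.
  rewrite mxE (bigD1 k)//= !mxE !eqxx mulr1 big1 ?addr0//.
  by move=> i ik; rewrite !mxE (negPf ik) mulr0.
rewrite eqxx mxE (_ : true%:R = \sum_i l i); last by rewrite l1.
rewrite big_ord_recl addrC -addrA -big_split/= big1 ?addr0//.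
by move=> k _; rewrite !mxE mulrN1 subrr.
Qed.

Let conv_comb_bary x : (\sum_j bary j x = 1) /\ conv_comb p (bary^~ x) = x.
Proof.
have bE k : bary (lift ord0 k) x = ((x - p ord0) *m invmx M) 0 k.
  rewrite /bary /bary_vec liftK addr0 mulmxA [LHS]mxE (bigD1 k)//= [delta_mx _ _ k 0]mxE !eqxx.
  rewrite mulr1 big1 ?addr0// => i ik.
  by rewrite [delta_mx _ _ _ _]mxE (negPf ik) mulr0.
have b0 : bary ord0 x = 1 - \sum_k bary (lift ord0 k) x.
  rewrite /bary /bary_vec unlift_none eqxx addrC; congr (_ + _).
  rewrite mulmxA mxE -sumrN; apply: eq_bigr => k _.
  by rewrite -bE [const_mx _ _ _]mxE mulrN1.
have s1 : \sum_j bary j x = 1 by rewrite big_ord_recl b0 subrK.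
split => //; apply/eqP; rewrite -subr_eq0 -(subrKA (p ord0)); apply/eqP.
have -> : conv_comb p (bary^~ x) - p ord0 = x - p ord0.
  rewrite -[RHS]mulmx1 -(mulVmx uM) mulmxA.
  apply/rowP => a; rewrite !mxE conv_comb_coord -[p ord0 0 a]mul1r -s1 mulr_suml.
  rewrite -sumrB big_ord_recl subrr add0r; apply: eq_bigr => k _.
  by rewrite bE !mxE mulrBr.
by rewrite addrC subrKA subrr.
Qed.

(** A closure point has nonnegative barycentric coordinates, by continuity; outside the body one of
    them is not positive, hence 0, and its zero set is a hyperplane. *)
Lemma simplex_boundary_null : (0 < d)%N ->
  mu.-negligible (closure (body (Simplex p)) `\` body (Simplex p)).
Proof.
move=> d0.
have [nu] := choice bary_affine => /choice[c hnu].
have bary_ge0 x j : closure (body (Simplex p)) x -> 0 <= bary j x.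
  move=> cx; rewrite leNgt; apply/negP => lt0.
  have : nbhs x [set y | \sum_k nu j 0 k * y 0 k < c j].
    apply: (cvgr_lt _ (@continuous_dot R d (nu j) x)).
    by rewrite -subr_lt0 -(hnu j).1.
  move=> /cx[_ [[l [l0 l1] <-]]] /=.
  rewrite -subr_lt0 -(hnu j).1 bary_conv_comb// ltNge.
  by rewrite ltW.
apply: (@negligibleS _ _ _ mu (\big[setU/set0]_(j < d.+1)
    hyperplane (nu j) (c j))).
  move=> x [cx nb].
  have [j bj] : exists j, ~ (0 < bary j x).
    apply/existsNP => h; apply: nb; exists (bary^~ x); last by case: (conv_comb_bary x).
    by split => //; case: (conv_comb_bary x).
  rewrite -bigcup_seq; exists j => /=; first by rewrite mem_index_enum.
  move: bj => /negP; rewrite -leNgt => bj.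
  have := bary_ge0 x j cx => bj'.
  have : bary j x = 0 by apply/eqP; rewrite eq_le bj bj'.
  by rewrite (hnu j).1 => /eqP; rewrite subr_eq0 => /eqP.
apply: big_ind => [|A B|j _]; first exact: negligible_set0.
  exact: negligibleU.
apply/negligibleP; first exact: measurable_hyperplane.
by apply: hyperplane_null; exact: (hnu j).2.
Qed.

End simplex.

Lemma boundary_null (e : element R d) : (0 < d)%N -> Defs.nondegenerate e ->
  mu.-negligible (closure (body e) `\` body e).
Proof.
by case: e => p d0; [move=> h; exact: simplex_boundary_null
                    |exact: box_boundary_null].
Qed.

Lemma subdivision_null (Om : set pt) n (elt : 'I_n -> element R d) : (0 < d)%N ->
  subdivision Om elt ->
  mu.-negligible (Om `\` \bigcup_i body (elt i)).
Proof.
move=> d0 [hT _ clOm].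
apply: (@negligibleS _ _ _ mu (\big[setU/set0]_(i < n)
    (closure (body (elt i)) `\` body (elt i)))).
  move=> x [Omx nx].
  have : closure Om x by exact: subset_closure.
  rewrite clOm => -[i _ ci]; rewrite -bigcup_seq; exists i => /=.
    by rewrite mem_index_enum.
  by split => // bi; apply: nx; exists i.
apply: big_ind => [|A B|i _]; first exact: negligible_set0.
  exact: negligibleU.
by apply: boundary_null => //; have [] := hT i.
Qed.

End elements.

(** * Integrability and coercivity of the diffusion form *)

Section broken_form.
Context (R : realType) (d : nat).
Local Notation pt := 'rV[R]_d.
Local Notation mu := (@leb R d).
Implicit Types (D : set pt) (g h k : pt -> pt) (A : pt -> 'M[R]_d).

(** The integrand of [a_form], with arbitrary fields for the gradients; [k] is the side of the test
    function. *)
Definition form A k g (x : pt) : R := (k x *m (A x *m (g x)^T)) 0 0.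

Lemma formE A k g x :
  form A k g x = \sum_a \sum_b A x a b * (k x 0 a * g x 0 b).
Proof.
rewrite /form mxE; apply: eq_bigr => a _; rewrite mxE mulr_sumr.
by apply: eq_bigr => b _; rewrite mxE mulrCA.
Qed.

Lemma form_lin A k g h (c : R) x :
  form A k (fun x => c *: g x + h x) x = c * form A k g x + form A k h x.
Proof.
rewrite /form linearD linearZ/= !mulmxDr -!scalemxAr mxE; congr (_ + _).
by rewrite mxE.
Qed.

Lemma Linfty_subset D D' u : measurable D -> measurable D' -> D' `<=` D ->
  Linfty D u -> Linfty D' u.
Proof.
move=> mD mD' sD [mu_u [M hM]]; split; first exact: measurable_funS sD mu_u.
by exists M; apply: filterS hM => x h /sD.
Qed.

Lemma Linfty_integrableM D (a f : pt -> R) : measurable D -> Linfty D a ->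
  mu.-integrable D (EFin \o f) ->
  mu.-integrable D (EFin \o (fun x => a x * f x)).
Proof.
move=> mD [ma [M hM]] fi; have mf := measurable_int _ fi.
have iMf : mu.-integrable D (fun x => M%:E * (EFin \o f) x)%E.
  exact: integrableZl.
have maf : measurable_fun D (EFin \o (fun x => a x * f x)).
  by apply/measurable_EFinP; apply: measurable_funM => //; exact/measurable_EFinP.
apply/integrableP; split => //.
move/integrableP : iMf => [mMf]; apply: le_lt_trans.
apply: ae_ge0_le_integral => //.
- exact: measurableT_comp maf.
- exact: measurableT_comp mMf.
- apply: filterS hM => x hx Dx /=; rewrite lee_fin !normrM ler_wpM2r//.
  exact: le_trans (hx Dx) (ler_norm _).
Qed.

Lemma integrable_EFin_sum D (I : finType) (f : I -> pt -> R) : measurable D ->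
  (forall i, mu.-integrable D (EFin \o f i)) ->
  mu.-integrable D (EFin \o (fun x => \sum_i f i x)).
Proof.
move=> mD fi.
rewrite (_ : EFin \o _ = (fun x => \sum_i (EFin \o f i) x)%E).
  by apply: integrable_sum => // i _; exact: fi.
by apply/funext => x /=; rewrite sumEFin.
Qed.

Lemma integrable_form D A k g : measurable D ->
  (forall i j, Linfty D (fun x => A x i j)) ->
  (forall i, L2 D (fun x => k x 0 i)) -> (forall i, L2 D (fun x => g x 0 i)) ->
  mu.-integrable D (EFin \o form A k g).
Proof.
move=> mD hA k2 g2.
rewrite (_ : form A k g = fun x => \sum_a \sum_b A x a b * (k x 0 a * g x 0 b)).
  apply: integrable_EFin_sum => // a; apply: integrable_EFin_sum => // b.
  by apply: Linfty_integrableM => //; exact: L2_integrableM.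
by apply/funext => x; rewrite formE.
Qed.

(** Almost everywhere [q] is its own absolute value, so both claims reduce to the integral of
    [|q|]. *)
Lemma ae_ge0_Rintegral D (q : pt -> R) : measurable D ->
  mu.-integrable D (EFin \o q) -> {ae mu, forall x, D x -> 0 <= q x} ->
  0 <= \int[mu]_(x in D) q x /\
  (\int[mu]_(x in D) q x = 0 -> {ae mu, forall x, D x -> q x = 0}).
Proof.
move=> mD qi q0; have mq := measurable_int _ qi.
have mq' : measurable_fun D q by exact/measurable_EFinP.
have qE : \int[mu]_(x in D) q x = \int[mu]_(x in D) `|q x|.
  apply: ae_eq_Rintegral => //; first exact: measurableT_comp.
  by apply: filterS q0 => x h Dx; rewrite ger0_norm// h.
split; first by rewrite qE; apply: Rintegral_ge0 => x _; exact: normr_ge0.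
rewrite qE => e.
have h : (\int[mu]_(x in D) `|(EFin \o q) x| = 0)%E.
  rewrite -[LHS]fineK; first by congr EFin; exact: e.
  exact: (integrable_fin_num mD (integrable_abse qi)).
move/(ae_eq_integral_abs mu mD mq) : h.
by apply: filterS => x /= h Dx; have := h Dx => -[].
Qed.

Lemma form_coercive_eq0 (alpha : R) A k x : 0 < alpha ->
  (forall xi : 'cV[R]_d,
    alpha * (xi^T *m xi) 0 0 <= (xi^T *m A x *m xi) 0 0) ->
  0 <= form A k k x /\ (form A k k x = 0 -> k x = 0).
Proof.
move=> a0 /(_ (k x)^T); rewrite trmxK -mulmxA -/(form A k k x).
have -> : (k x *m (k x)^T) 0 0 = \sum_i k x 0 i ^+ 2.
  by rewrite mxE; apply: eq_bigr => i _; rewrite mxE expr2.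
have s0 : 0 <= \sum_i k x 0 i ^+ 2 by apply: sumr_ge0 => i _; exact: sqr_ge0.
move=> h; split; first by apply: le_trans h; rewrite mulr_ge0// ltW.
move=> q0; move: h; rewrite q0 pmulr_rle0// => h.
have : \sum_i k x 0 i ^+ 2 == 0 by rewrite eq_le h s0.
rewrite psumr_eq0; last by move=> i _; exact: sqr_ge0.
move=> /allP hk; apply/rowP => i; rewrite mxE.
by have := hk i (mem_index_enum _); rewrite sqrf_eq0 => /eqP.
Qed.

End broken_form.

(** * Finite element spaces are closed under linear combinations *)

Section finite_element_spaces.
Context (R : realType) (d : nat).
Local Notation pt := 'rV[R]_d.
Local Notation mu := (@leb R d).
Context (Om : set pt) (n : nat) (elt : 'I_n -> element R d).
Context (kind : 'I_n -> poly_kind) (r : nat).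
Context (oOm : open Om) (bOm : (mu Om < +oo)%E).

Lemma poly_space_lin kd (c : R) (p q : pt -> R) : poly_space kd r p ->
  poly_space kd r q -> poly_space kd r (fun x => c * p x + q x).
Proof.
move=> [a [a0 ->]] [b [b0 ->]]; exists (fun m => c * a m + b m); split.
  by move=> hk m hm; rewrite a0// b0// mulr0 addr0.
apply/funext => x; rewrite mulr_sumr -big_split/=; apply: eq_bigr => m _.
by rewrite mulrDl mulrA.
Qed.

Lemma Vh_lin (c : R) u v : Vh Om elt kind r u -> Vh Om elt kind r v ->
  Vh Om elt kind r (fun x => c * u x + v x).
Proof.
move=> [u2 up] [v2 vp]; split; first exact: (L2_lin c (measurable_open_rV oOm)).
move=> i; have [p hp up'] := up i; have [q hq vq'] := vp i.
exists (fun x => c * p x + q x); first exact: poly_space_lin.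
by apply: filterS2 up' vq' => x h1 h2 Tx; rewrite h1// h2.
Qed.

Lemma Vhc_lin (c : R) u v : Vhc Om elt kind r u -> Vhc Om elt kind r v ->
  Vhc Om elt kind r (fun x => c * u x + v x).
Proof.
by move=> [u1 u2] [v1 v2]; split; [exact: Vh_lin|exact: H10_lin].
Qed.

End finite_element_spaces.

(** * From the elementwise form to the global gradient *)

Section broken_gradients.
Context (R : realType) (d : nat).
Local Notation pt := 'rV[R]_d.
Local Notation mu := (@leb R d).
Context (Om : set pt) (n : nat) (elt : 'I_n -> element R d).
Local Notation T i := (body (elt i)).
Context (oT : forall i, open (T i)) (TOm : forall i, T i `<=` Om).
Context (oOm : open Om) (bOm : bounded_set Om).

Let mT i : measurable (T i) := measurable_open_rV (@oT i).
Let mOm : measurable Om := measurable_open_rV oOm.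

Lemma element_measure_lty i : (mu (T i) < +oo)%E.
Proof.
apply: le_lt_trans (bounded_measure_lty mOm bOm).
by apply: le_measure; rewrite ?inE; [exact: (@mT i)|exact: mOm|exact: TOm].
Qed.

(** On each element the integral of [form] at [w] twice is the difference of the two given terms;
    summing gives 0, and nonnegative terms vanish one by one. The relation between [w], [u] and [v]
    is asked almost everywhere because [E w] meets it only in that sense. *)
Lemma a_form_definite (A : pt -> 'M[R]_d) (u v w : pt -> R) :
  diffusion_tensor Om A ->
  brokenH1 elt u -> brokenH1 elt v -> brokenH1 elt w ->
  (forall i, {ae mu, forall x, T i x -> -1 * v x + u x = w x}) ->
  a_form elt A u w = a_form elt A v w ->
  forall i, {ae mu, forall x, T i x -> wgrad (T i) w x = 0}.
Proof.
move=> [hAoo [alpha alpha0 hAalpha]] u1 v1 w1 vuw auv.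
pose g i := wgrad (T i) u; pose h i := wgrad (T i) v; pose k i := wgrad (T i) w.
have ug i : is_weak_grad (T i) u (g i) by exact: wgradP (u1 i).
have vh i : is_weak_grad (T i) v (h i) by exact: wgradP (v1 i).
have wk i : is_weak_grad (T i) w (k i) by exact: wgradP (w1 i).
have vu2 i : L2 (T i) (fun x => -1 * v x + u x).
  exact: (L2_lin (-1) (@mT i) (v1 i).1 (u1 i).1).
(* A second weak gradient of [w], explicit in those of [u] and [v]; uniqueness will identify it with
   the chosen [k i]. *)
have wgh i : is_weak_grad (T i) w (fun x => -1 *: h i x + g i x).
  apply: (weak_grad_ae (@mT i) (vu2 i).1 (w1 i).1.1 (vuw i)).
  exact: (weak_grad_lin (-1) (@mT i) (v1 i).1 (u1 i).1 (vh i) (ug i)).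
have fi i (G : pt -> pt) : (forall a, L2 (T i) (fun x => G x 0 a)) ->
    mu.-integrable (T i) (EFin \o form A (k i) G).
  move=> G2; apply: (integrable_form (@mT i) _ (wk i).1 G2) => a b.
  exact: (Linfty_subset mOm (@mT i) (@TOm i) (hAoo a b)).
have eI i : \int[mu]_(x in T i) form A (k i) (k i) x =
    \int[mu]_(x in T i) form A (k i) (g i) x -
    \int[mu]_(x in T i) form A (k i) (h i) x.
  have ih := fi i _ (vh i).1; have ig := fi i _ (ug i).1.
  have ik := fi i _ (wk i).1; have igh := fi i _ (wgh i).1.
  rewrite addrC -mulN1r -(RintegralZl _ (@mT i) ih).
  rewrite -(RintegralD (@mT i) (integrableZl (@mT i) (-1) ih) ig).
  transitivity (\int[mu]_(x in T i) form A (k i) (fun x => -1 *: h i x + g i x) x).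
    apply: (ae_eq_Rintegral (@mT i)).
    - by apply/measurable_EFinP; exact: measurable_int ik.
    - by apply/measurable_EFinP; exact: measurable_int igh.
    - have := weak_grad_unique (@oT i) (element_measure_lty i) (wk i) (wgh i).
      by apply: filterS => x e Tx; rewrite [in RHS]/form -(e Tx).
  by apply: eq_Rintegral => x _; exact: form_lin.
have qge0 i : {ae mu, forall x, T i x -> 0 <= form A (k i) (k i) x}.
  apply: filterS hAalpha => x hx Tx.
  exact: (form_coercive_eq0 (k i) alpha0 (hx (TOm Tx))).1.
have qint i := ae_ge0_Rintegral (@mT i) (fi i _ (wk i).1) (qge0 i).
have sum0 : \sum_(i < n) \int[mu]_(x in T i) form A (k i) (k i) x = 0.
  rewrite (eq_bigr _ (fun i _ => eI i)) sumrB.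
  by apply/eqP; rewrite subr_eq0; apply/eqP; exact: auv.
move=> i.
move/eqP: sum0; rewrite psumr_eq0; last by move=> j _; exact: (qint j).1.
move=> /allP/(_ i (mem_index_enum _))/eqP/(qint i).2 q0.
apply: filterS2 q0 hAalpha => x q0 hx Tx.
exact: (form_coercive_eq0 (k i) alpha0 (hx (TOm Tx))).2 (q0 Tx).
Qed.

(** The global gradient restricts to a weak gradient on each element, so it vanishes there almost
    everywhere, and the elements miss only a null set of [Om]. *)
Lemma wgrad_elements_eq0 (w : pt -> R) : (0 < d)%N -> subdivision Om elt ->
  H1 Om w -> (forall i, {ae mu, forall x, T i x -> wgrad (T i) w x = 0}) ->
  {ae mu, forall x, Om x -> wgrad Om w x = 0}.
Proof.
move=> d0 sub w1 k0; have wG := wgradP w1.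
have GT : {ae mu, forall x, forall i, T i x -> wgrad Om w x = 0}.
  apply: filter_forall => i.
  have wGT := weak_grad_subset mOm (@mT i) (@TOm i) wG.
  have wk := wgradP (H1_subset mOm (@mT i) (@TOm i) w1).
  apply: filterS2 (weak_grad_unique (@oT i) (element_measure_lty i) wGT wk) (k0 i).
  by move=> x e1 e2 Tx; rewrite (e1 Tx) (e2 Tx).
have nul : {ae mu, forall x, Om x -> exists i, T i x}.
  apply: negligibleS (subdivision_null d0 sub) => x /= /not_implyP[Omx nx].
  by split => // -[i _ Tx]; apply: nx; exists i.
by apply: filterS2 GT nul => x e1 e2 Omx; have [i] := e2 Omx; exact: e1.
Qed.

End broken_gradients.

Theorem lemma3p1 (R : realType) (d : nat) (hd : d = 2%N \/ d = 3%N)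
    (Om : set 'rV[R]_d) (hOm : polygonal_domain Om)
    (n : nat) (elt : 'I_n -> element R d) (hmesh : admissible_mesh Om elt)
    (kind : 'I_n -> poly_kind)
    (A : 'rV[R]_d -> 'M[R]_d) (hA : diffusion_tensor Om A)
    (f : ('rV[R]_d -> R) -> R) (hf : Hm1 Om f)
    (ell : ('rV[R]_d -> R) -> R) (hell : load Om elt f ell)
    (r : nat)
    (Vt : set ('rV[R]_d -> R)) (hVt : recovery_space Om elt kind Vt)
    (E : ('rV[R]_d -> R) -> ('rV[R]_d -> R))
    (hE : recovery_operator Om elt kind r Vt E)
    (hE_preserves : preserves_conforming Om elt kind r E)
    (hE_range : forall v, Vh Om elt kind r v -> Vhc Om elt kind r (E v))
    (s : ('rV[R]_d -> R) -> ('rV[R]_d -> R) -> R)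
    (hs : stabilisation Om elt kind r s)
    (hs_conforming : forall w v, Vh Om elt kind r w ->
      Vhc Om elt kind r v -> s w v = 0)
    (u : 'rV[R]_d -> R) (hu : solves_RFEM Om elt kind r A ell E s u)
    (uFEM : 'rV[R]_d -> R) (huFEM : solves_FEM Om elt kind r A ell uFEM) :
  E u = uFEM %[ae @leb R d in Om].
Proof.
have d0 : (0 < d)%N by case: hd => ->.
have [oOm _ _ bOm _] := hOm.
have [sub _ _ _] := hmesh; have [hT _ _] := sub.
have mOm : measurable Om := measurable_open_rV oOm.
have oT i : open (body (elt i)) by have [] := hT i.
have TOm i : body (elt i) `<=` Om by have [] := hT i.
have H1T v : Vhc Om elt kind r v -> brokenH1 elt v.
  move=> [_ [v1 _]] i.
  exact: (H1_subset mOm (measurable_open_rV (oT i)) (TOm i) v1).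
have [Vu rfem] := hu; have [VF fem] := huFEM.
have VEu := hE_range u Vu.
have [w wE] : exists w : 'rV[R]_d -> R, w = (fun x => -1 * uFEM x + E u x).
  by eexists.
have Vw : Vhc Om elt kind r w.
  rewrite wE; apply: (Vhc_lin oOm _ (-1) VF VEu).
  exact: (bounded_measure_lty mOm bOm).
have VEw := hE_range w Vw.1.
have Eww := hE_preserves w Vw.
(* The R-FEM equation is tested with [w], the FEM equation with the representative [E w], conforming
   by [hE_range]. Both right-hand sides are then literally [ell (E w)], and nothing has to be moved
   between almost everywhere equal functions. *)
have ort : a_form elt A (E u) (E w) = a_form elt A uFEM (E w).
  have e := rfem w Vw.1; have s0 := hs_conforming u w Vu Vw.
  by rewrite (fem _ VEw) -e s0 addr0.
have grad0 : forall i, {ae @leb R d, forall x, body (elt i) x ->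
    wgrad (body (elt i)) (E w) x = 0}.
  apply: (a_form_definite oT TOm oOm bOm hA (H1T _ VEu) (H1T _ VF) (H1T _ VEw) _ ort).
  by move=> i; apply: filterS Eww => x e Tx; rewrite (e (TOm i x Tx)) wE.
have G0 := wgrad_elements_eq0 oT TOm oOm bOm d0 sub VEw.2.1 grad0.
(* [Ordinal d0] is the first coordinate direction, serving as the one direction of the Poincare
   inequality. *)
have w0 := H10_weak_grad_eq0 (Ordinal d0) oOm bOm VEw.2 (wgradP VEw.2.1) G0.
apply: filterS2 Eww w0 => x e e0 Omx.
apply/eqP; rewrite -subr_eq0 addrC -mulN1r; apply/eqP.
by rewrite -(e0 Omx) (e Omx) wE.
Qed.
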